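(* Let $\theta\in(0,2\pi)$, where it is supposed without loss of generality that $\cos\theta>0$, and let $\epsilon$ be given such that $0<\epsilon<\tfrac12\cos\theta$. Let $f_K(y;\theta)=\dfrac1\pi\dfrac{\sin\theta}{(1-y^2)\sqrt{\cos^2\theta-y^2}}\,\mathbf 1_{\{|y|\le\cos\theta\}}$ for $y\in\mathbb{R}$. Then for all $(y_1,y_2)$ with $-\cos\theta+\epsilon\le y_1<y_2\le\cos\theta-\epsilon$, $$\lim_{n\to\infty} n\int_{\frac1n\lfloor ny_1\rfloor}^{\frac1n\lfloor ny_2\rfloor}e^{2n\theta}\Big|\sum_{j=1,2}I_n(0,\lceil an\rceil;B_j)\Big|^2da=\frac18\int_{y_1}^{y_2}(1+a)^2f_K(a;\theta)\,da,$$ $$\lim_{n\to\infty} n\int_{\frac1n\lfloor ny_1\rfloor}^{\frac1n\lfloor ny_2\rfloor}e^{2n\theta}\Big|\sum_{j=1,2}I_n(1,\lceil an\rceil;B_j)\Big|^2da=\frac18\int_{y_1}^{y_2}(1-a^2)f_K(a;\theta)\,da,$$ $$\lim_{n\to\infty} n\int_{\frac1n\lfloor ny_1\rfloor}^{\frac1n\lfloor ny_2\rfloor}e^{2n\theta}\Big(\sum_{j=1,2}I_n(0,\lceil an\rceil;B_j)\Big)\overline{\Big(\sum_{j=1,2}I_n(1,\lceil an\rceil;B_j)\Big)}\,da=\frac18\int_{y_1}^{y_2}a(1+a)\tan\theta\, f_K(a;\theta)\,da,$$ where the integrals $I_n(s,t;B_j)$ are defined in the context.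
   Context: Let $\Omega=\{0,1,2,3\}$ and $p_0=\tfrac{e^{-\theta}}2(\cosh\theta+\cos\theta)$, $p_1=\tfrac{e^{-\theta}}2(\sinh\theta+\sin\theta)$, $p_2=\tfrac{e^{-\theta}}2(\cosh\theta-\cos\theta)$, $p_3=\tfrac{e^{-\theta}}2(\sinh\theta-\sin\theta)$. For $k\in(-\pi,\pi)$, $P_k$ is the $4\times4$ matrix indexed by $\Omega$ with entries $P_k(s',s)=e^{ik(-1)^{s'}}p_{(s-s')\bmod 4}$. The subspace $\mathrm{span}\{e_0-e_2,e_1-e_3\}$ of $\mathbb{C}^4$ is invariant under $P_k$, and on it $P_k$ is represented by the diagonalizable matrix $B(k)=e^{-\theta}\begin{bmatrix}e^{ik}\cos\theta&e^{ik}\sin\theta\\-e^{-ik}\sin\theta&e^{-ik}\cos\theta\end{bmatrix}$, with eigenvalues $$\lambda_{B,1}(k)=e^{-\theta}\big[\cos k\cos\theta+i\sqrt{1-\cos^2k\cos^2\theta}\big],\qquad \lambda_{B,2}(k)=e^{-\theta}\big[\cos k\cos\theta-i\sqrt{1-\cos^2k\cos^2\theta}\big].$$ For $k\in(-\pi,\pi)$, let $r_{B,j}(k)=(r_{B,j}(k,s))_{s\in\Omega}$ be a right eigenvector, $P_kr_{B,j}(k)=\lambda_{B,j}(k)r_{B,j}(k)$, lying in $\mathrm{span}\{e_0-e_2,e_1-e_3\}$, and let $\ell_{B,j}(k)=(\ell_{B,j}(k,s))_{s\in\Omega}$ be a left eigenvector (row vector), $\ell_{B,j}(k)P_k=\lambda_{B,j}(k)\ell_{B,j}(k)$,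 with $\ell_{B,j}(k,0)=-\ell_{B,j}(k,2)$ and $\ell_{B,j}(k,1)=-\ell_{B,j}(k,3)$, normalized by $\sum_{s\in\Omega}\ell_{B,j}(k,s)r_{B,j}(k,s)=1$. Define for $s\in\Omega$, $t\in\mathbb{Z}$, $j=1,2$: $$I_n(s,t;B_j)=\frac1{2\pi}\int_{-\pi}^{\pi}r_{B,j}(k,0)\,\ell_{B,j}(k,s)\,\lambda_{B,j}(k)^n\,e^{-ikt}\,dk.$$
   Formalization: In f_K the numerator sin θ is replaced by |sin θ|: for θ in (3π/2, 2π) one has cos θ > 0 but sin θ < 0, and the first two printed limits would equate a limit of nonnegative numbers with a negative number. For sin θ > 0 nothing changes. *)

(* Defs.v *)
From Stdlib Require Import Reals Zfloor.
From Coquelicot Require Import Coquelicot.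
Open Scope R_scope.

Definition p (theta : R) (m : nat) : R :=
  match m with
  | 0%nat => exp (- theta) / 2 * (cosh theta + cos theta)
  | 1%nat => exp (- theta) / 2 * (sinh theta + sin theta)
  | 2%nat => exp (- theta) / 2 * (cosh theta - cos theta)
  | _ => exp (- theta) / 2 * (sinh theta - sin theta)
  end.

(* exp (i x) *)
Definition cis (x : R) : C := (cos x, sin x).

(* For s, s' < 4 the natural number (s + 4 - s') mod 4 is s - s' modulo 4. *)
Definition P (theta k : R) : @matrix C 4 4 :=
  mk_matrix 4 4 (fun s' s =>
    (cis (k * (-1) ^ s') * p theta ((s + 4 - s') mod 4))%C).

Definition lambdaB (theta : R) (j : nat) (k : R) : C :=
  let root := sqrt (1 - cos k ^ 2 * cos theta ^ 2) in
  (exp (- theta) *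
   (cos k * cos theta + Ci * (match j with 1%nat => root | _ => - root end)%R))%C.

Definition e (m : nat) : @matrix C 4 1 :=
  mk_matrix 4 1 (fun s _ => if Nat.eqb s m then RtoC 1 else RtoC 0).

Definition cval (v : @matrix C 4 1) (s : nat) : C := coeff_mat (RtoC 0) v s 0.
Definition rval (w : @matrix C 1 4) (s : nat) : C := coeff_mat (RtoC 0) w 0 s.

(* Coquelicot's scal on matrices takes square matrices, not numbers, as scalars. *)
Definition mscal {m n : nat} (a : C) (A : @matrix C m n) : @matrix C m n :=
  mk_matrix m n (fun i j => (a * coeff_mat (RtoC 0) A i j)%C).

Definition right_eigenvector (A : @matrix C 4 4) (lam : C) (v : @matrix C 4 1)
  : Prop :=
  v <> Mzero /\ Mmult A v = mscal lam v.

Definition left_eigenvector (A : @matrix C 4 4) (lam : C) (w : @matrix C 1 4)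
  : Prop :=
  w <> Mzero /\ Mmult w A = mscal lam w.

Definition in_span (v : @matrix C 4 1) : Prop :=
  exists a b : C,
    v = Mplus (mscal a (Mplus (e 0) (Mopp (e 2))))
              (mscal b (Mplus (e 1) (Mopp (e 3)))).

Definition B_eigensystem (theta : R) (r : nat -> R -> @matrix C 4 1)
    (l : nat -> R -> @matrix C 1 4) : Prop :=
  forall (j : nat) (k : R), j = 1%nat \/ j = 2%nat -> - PI < k < PI ->
    right_eigenvector (P theta k) (lambdaB theta j k) (r j k) /\
    in_span (r j k) /\
    left_eigenvector (P theta k) (lambdaB theta j k) (l j k) /\
    rval (l j k) 0 = (- rval (l j k) 2)%C /\
    rval (l j k) 1 = (- rval (l j k) 3)%C /\
    sum_n (fun s => (rval (l j k) s * cval (r j k) s)%C) 3 = RtoC 1.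

(* The integrand matters only on the open interval (-PI, PI), since RInt does
   not depend on the values at the end points. *)
Definition I_B (theta : R) (r : nat -> R -> @matrix C 4 1)
    (l : nat -> R -> @matrix C 1 4) (n s : nat) (t : Z) (j : nat) : C :=
  ((1 / (2 * PI))%R *
   RInt (V := C_R_CompleteNormedModule)
     (fun k => cval (r j k) 0 * rval (l j k) s * lambdaB theta j k ^ n
               * cis (- (k * IZR t))) (- PI) PI)%C.

Definition I_B_sum (theta : R) (r : nat -> R -> @matrix C 4 1)
    (l : nat -> R -> @matrix C 1 4) (n s : nat) (t : Z) : C :=
  sum_n_m (fun j => I_B theta r l n s t j) 1 2.

(* The absolute value makes fK the Konno density, which is nonnegative: the
   condition cos theta > 0 allows theta in (3 PI / 2, 2 PI), where sin theta < 0
   and the formula with sin theta instead would be negative. *)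
Definition fK (y theta : R) : R :=
  1 / PI * (Rabs (sin theta) / ((1 - y ^ 2) * sqrt (cos theta ^ 2 - y ^ 2)))
  * (if Rle_dec (Rabs y) (cos theta) then 1 else 0).

(* Main.v *)
Require Import Defs.
From Stdlib Require Import Reals Zfloor Lra Lia ZArith.
From Coquelicot Require Import Coquelicot.
Open Scope R_scope.

(** The eigenvectors enter only through the products [r_j(k,0) l_j(k,s)], the
    first rows of the spectral projectors of [B(k)] (halved, because
    [e_0 - e_2] and [e_1 - e_3] have two nonzero entries each).  Hence
    [sum_j r_j(k,0) l_j(k,s) lambda_j^n] is half the first row of [B(k)^n], and
    [e^(n theta)] times its Fourier coefficients are half the amplitudes
    [A_n(t), B_n(t)] of a two-state quantum walk on the integers with unitary
    step [e^theta B(k)] ([I_B_sum_amplitude]).  These amplitudes are real and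
    vanish for [|t| > n].  Since [Zceil (a n)] is constant on cells of width
    [1 / n], the three expressions of the theorem are a quarter of the sums of
    [A_n^2], [B_n^2] and [A_n B_n] over [n y1 < t <= n y2].  What remains is the
    weak limit theorem for the walk, for an arbitrary real combination
    [psi = al A_n + be B_n]; the mixed sum follows by polarization.

    The eigenvalues of the step are [exp (i phi)] and [exp (- i phi)] with
    [cos phi = c cos k], and the walk spreads with the group velocity
    [vel = phi'].  In momentum space, multiplication by [t / n] is the operator
    [- (i / n) d/dk]; on a wave [p cos (n phi) + q sin (n phi)] it acts, up to
    [O (1 / n)], as multiplication by the velocity combined with an exchange of
    the amplitudes.  By Parseval the [m]-th moment of [psi^2] is therefore an
    integral over [k] of products of two such waves.  The terms that oscillate
    like [exp (2 i n phi)] disappear by the Riemann-Lebesgue argument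
    [wave_vanishes], and the moment tends to the mean of [vel^m * weight (vel)]
    over the circle ([moment_limit]).

    All positions satisfy [|t / n| <= 1], so convergence of the moments gives
    convergence of the means of Lipschitz functions by Bernstein's approximation
    theorem ([lipschitz_limit]), and then of the mass below a given velocity by
    squeezing between ramps ([below_limit]).  On [- PI / 2, PI / 2] the velocity
    increases from [- c] to [c] and [vel' * fK (vel) = 1 / PI], so the change of
    variables [a = vel k] turns the limit into an integral against [fK]
    ([walk_interval_limit]). *)

(** * Sums over intervals of integers *)

Fixpoint zsum (f : Z -> R) (a : Z) (len : nat) : R :=
  match len with
  | O => 0
  | S l => f a + zsum f (a + 1) l
  end.

Lemma zsum_ext f g len : forall a,
  (forall t, (a <= t < a + Z.of_nat len)%Z -> f t = g t) ->
  zsum f a len = zsum g a len.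
Proof.
  induction len as [|l IH]; intros a H; simpl; [reflexivity|].
  rewrite (H a) by lia. rewrite (IH (a + 1)%Z); [reflexivity|].
  intros t Ht. apply H. lia.
Qed.

Lemma zsum_zero f len : forall a,
  (forall t, (a <= t < a + Z.of_nat len)%Z -> f t = 0) -> zsum f a len = 0.
Proof.
  induction len as [|l IH]; intros a H; simpl; [reflexivity|].
  rewrite (H a) by lia. rewrite IH; [lra|]. intros t Ht. apply H. lia.
Qed.

Lemma zsum_plus f g len : forall a,
  zsum (fun t => f t + g t) a len = zsum f a len + zsum g a len.
Proof. induction len as [|l IH]; intros a; simpl; [lra|]. rewrite IH. lra. Qed.

Lemma zsum_scal x f len : forall a,
  zsum (fun t => x * f t) a len = x * zsum f a len.
Proof. induction len as [|l IH]; intros a; simpl; [lra|]. rewrite IH. lra. Qed.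

Lemma zsum_le f g len : forall a,
  (forall t, (a <= t < a + Z.of_nat len)%Z -> f t <= g t) ->
  zsum f a len <= zsum g a len.
Proof.
  induction len as [|l IH]; intros a H; simpl; [lra|].
  apply Rplus_le_compat; [apply H; lia|]. apply IH. intros t Ht. apply H. lia.
Qed.

Lemma zsum_cat f l1 l2 : forall a,
  zsum f a (l1 + l2) = zsum f a l1 + zsum f (a + Z.of_nat l1) l2.
Proof.
  induction l1 as [|l IH]; intros a.
  - simpl. rewrite Z.add_0_r. lra.
  - simpl. rewrite IH.
    replace (a + Z.pos (Pos.of_succ_nat l))%Z with (a + 1 + Z.of_nat l)%Z by lia.
    lra.
Qed.

Lemma zsum_shift f d len : forall a,
  zsum (fun t => f (t + d)%Z) a len = zsum f (a + d) len.
Proof.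
  induction len as [|l IH]; intros a; simpl; [reflexivity|].
  rewrite IH. do 2 f_equal. lia.
Qed.

Lemma is_derive_zsum (f df : Z -> R -> R) (x : R) len : forall a,
  (forall t, is_derive (f t) x (df t x)) ->
  is_derive (fun y => zsum (fun t => f t y) a len) x
            (zsum (fun t => df t x) a len).
Proof.
  induction len as [|l IH]; intros a H; simpl.
  - apply (is_derive_const (K := R_AbsRing) (V := R_NormedModule) 0).
  - apply (is_derive_plus (K := R_AbsRing) (V := R_NormedModule)).
    + apply H.
    + apply IH, H.
Qed.

Lemma is_RInt_zsum (f : Z -> R -> R) (I : Z -> R) (u v : R) len : forall a,
  (forall t, (a <= t < a + Z.of_nat len)%Z -> is_RInt (f t) u v (I t)) ->
  is_RInt (fun x => zsum (fun t => f t x) a len) u v (zsum I a len).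
Proof.
  induction len as [|l IH]; intros a H; simpl.
  - evar_last; [apply (is_RInt_const (V := R_NormedModule))|].
    unfold scal; simpl; unfold mult; simpl; ring.
  - apply (is_RInt_plus (V := R_NormedModule)); [apply H; lia|].
    apply IH. intros t Ht. apply H. lia.
Qed.

(** A finitely supported function has the same sum over every window that
    contains its support, so a shift of the index costs nothing as long as the
    function vanishes at the ends of the window. *)
Definition window_sum (M : nat) (f : Z -> R) : R := zsum f (- Z.of_nat M) (2 * M + 1).

Lemma window_sum_shift_down M f :
  f (Z.of_nat M) = 0 -> f (- Z.of_nat M - 1)%Z = 0 ->
  window_sum M (fun t => f (t - 1)%Z) = window_sum M f.
Proof.
  intros H1 H2. unfold window_sum.
  rewrite (zsum_shift f (-1)).
  replace (2 * M + 1)%nat with (1 + 2 * M)%nat by lia.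
  rewrite zsum_cat. replace (1 + 2 * M)%nat with (2 * M + 1)%nat by lia.
  rewrite zsum_cat. simpl.
  replace (- Z.of_nat M + -1)%Z with (- Z.of_nat M - 1)%Z by lia.
  replace (- Z.of_nat M - 1 + 1)%Z with (- Z.of_nat M)%Z by lia.
  replace (- Z.of_nat M + Z.of_nat (M + (M + 0)))%Z with (Z.of_nat M) by lia.
  rewrite H1, H2. lra.
Qed.

Lemma window_sum_shift_up M f :
  f (- Z.of_nat M)%Z = 0 -> f (Z.of_nat M + 1)%Z = 0 ->
  window_sum M (fun t => f (t + 1)%Z) = window_sum M f.
Proof.
  intros H1 H2. rewrite <- (window_sum_shift_down M (fun t => f (t + 1)%Z)).
  - apply zsum_ext. intros t _. f_equal. lia.
  - exact H2.
  - rewrite <- H1. f_equal. lia.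
Qed.

(** * Polynomial approximation of Lipschitz functions *)

(** The clauses match the use of the predicate: moments of all orders are known,
    and multiplication by [x] raises the order of a moment. *)
Inductive polynomial : (R -> R) -> Prop :=
| polynomial_const (a : R) : polynomial (fun _ => a)
| polynomial_mulx (f : R -> R) : polynomial f -> polynomial (fun x => x * f x)
| polynomial_plus (f g : R -> R) :
    polynomial f -> polynomial g -> polynomial (fun x => f x + g x)
| polynomial_ext (f g : R -> R) :
    (forall x, f x = g x) -> polynomial f -> polynomial g.

Lemma polynomial_scal a f : polynomial f -> polynomial (fun x => a * f x).
Proof.
  induction 1 as [b|f _ IH|f g _ IHf _ IHg|f g E _ IH].
  - apply polynomial_const.
  - eapply polynomial_ext; [|apply (polynomial_mulx _ IH)].
    intros x; simpl; ring.
  - eapply polynomial_ext; [|apply (polynomial_plus _ _ IHf IHg)].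
    intros x; simpl; ring.
  - eapply polynomial_ext; [|exact IH]. intros x; simpl. now rewrite E.
Qed.

(** The expectation of [f] at the end of a walk of [N] independent steps of
    length 1 whose drift is [x], each step going up with probability
    [(1 + x) / 2].  It is a polynomial in [x], the Bernstein polynomial of [f]
    transported to the interval [-1, 1]. *)
Fixpoint coin (N : nat) (f : R -> R) (x : R) : R :=
  match N with
  | O => f 0
  | S N => (1 + x) / 2 * coin N (fun u => f (u + 1)) x
           + (1 - x) / 2 * coin N (fun u => f (u - 1)) x
  end.

Lemma coin_polynomial N : forall f, polynomial (coin N f).
Proof.
  induction N as [|N IH]; intros f; simpl; [apply polynomial_const|].
  pose proof (IH (fun u => f (u + 1))) as Hp.
  pose proof (IH (fun u => f (u - 1))) as Hm.
  apply (polynomial_ext (fun x =>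
    (/ 2 * coin N (fun u => f (u + 1)) x + / 2 * coin N (fun u => f (u - 1)) x)
    + x * (/ 2 * coin N (fun u => f (u + 1)) x
           + - / 2 * coin N (fun u => f (u - 1)) x))).
  - intros x. field.
  - apply polynomial_plus; [|apply polynomial_mulx];
      apply polynomial_plus; apply polynomial_scal; assumption.
Qed.

Lemma coin_le N x : -1 <= x <= 1 -> forall f g,
  (forall u, f u <= g u) -> coin N f x <= coin N g x.
Proof.
  intros Hx. induction N as [|N IH]; intros f g H; simpl; [apply H|].
  apply Rplus_le_compat; (apply Rmult_le_compat_l; [lra|]); apply IH;
    intros u; apply H.
Qed.

Lemma coin_ext N x : forall f g,
  (forall u, f u = g u) -> coin N f x = coin N g x.
Proof.
  induction N as [|N IH]; intros f g H; simpl; [apply H|].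
  f_equal; f_equal; apply IH; intros u; apply H.
Qed.

Lemma coin_affine N x a b : forall f,
  coin N (fun u => a + b * f u) x = a + b * coin N f x.
Proof.
  induction N as [|N IH]; intros f; simpl; [reflexivity|].
  rewrite (IH (fun u => f (u + 1))), (IH (fun u => f (u - 1))). field.
Qed.

(** For [a = - N x] this is the variance of the walk; a general [a] is needed for
    the induction. *)
Lemma coin_square N x : forall a,
  coin N (fun u => (u + a) ^ 2) x = (INR N * x + a) ^ 2 + INR N * (1 - x ^ 2).
Proof.
  induction N as [|N IH]; intros a; [simpl; ring|].
  simpl coin.
  rewrite (coin_ext N x _ (fun u => (u + (a + 1)) ^ 2)) by (intros; ring).
  rewrite (coin_ext N x (fun u => (u - 1 + a) * _) (fun u => (u + (a - 1)) ^ 2))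
    by (intros; ring).
  rewrite !IH, S_INR. field.
Qed.

Definition lipschitz (L : R) (g : R -> R) : Prop :=
  forall x y, Rabs (g x - g y) <= L * Rabs (x - y).

(** Bernstein's proof of the theorem of Weierstrass: the walk at time [N]
    divided by [N] has mean [x] and variance at most [1 / N]. *)
Lemma lipschitz_approx g L : 0 <= L -> lipschitz L g ->
  forall e, 0 < e -> exists q, polynomial q /\
    forall x, -1 <= x <= 1 -> Rabs (q x - g x) <= e.
Proof.
  intros HL Hg e He.
  (* [L d / 2] is at most [e / 4], and [N > 1 / d^2] makes the variance term no
     larger. *)
  set (d := e / (2 * (L + 1))).
  assert (Hd : 0 < d) by (apply Rdiv_lt_0_compat; lra).
  destruct (nfloor_ex (/ (d * d))) as [N0 [_ HN0]].
  { apply Rlt_le, Rinv_0_lt_compat. nra. }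
  set (N := S N0). assert (HN : / (d * d) < INR N) by (unfold N; rewrite S_INR; lra).
  assert (HNp : 0 < INR N) by (apply lt_0_INR; unfold N; lia).
  exists (coin N (fun u => g (u / INR N))). split; [apply coin_polynomial|].
  intros x Hx.
  (* Cauchy-Schwarz is replaced by the pointwise bound 2|w| <= d + w^2 / d. *)
  assert (Hpt : forall u, Rabs (g (u / INR N) - g x) <=
     L / 2 * d + L / (2 * d * INR N ^ 2) * (u + - (INR N * x)) ^ 2).
  { intros u. eapply Rle_trans; [apply Hg|].
    set (w := u / INR N - x).
    replace (L / (2 * d * INR N ^ 2) * (u + - (INR N * x)) ^ 2)
      with (L / 2 * (w ^ 2 / d)) by (unfold w; field; lra).
    rewrite <- (Rmult_plus_distr_l (L / 2)).
    replace (L * Rabs w) with (L / 2 * (2 * Rabs w)) by field.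
    apply Rmult_le_compat_l; [lra|].
    rewrite <- (pow2_abs w).
    apply (Rmult_le_reg_r d); [lra|].
    replace ((d + Rabs w ^ 2 / d) * d) with (d ^ 2 + Rabs w ^ 2) by (field; lra).
    pose proof (pow2_ge_0 (d - Rabs w)). nra. }
  set (K := L / 2 * d + L / (2 * d * INR N ^ 2) * (INR N * (1 - x ^ 2))).
  assert (HE : coin N (fun u => L / 2 * d +
        L / (2 * d * INR N ^ 2) * (u + - (INR N * x)) ^ 2) x = K).
  { rewrite (coin_affine N x (L / 2 * d) (L / (2 * d * INR N ^ 2))
               (fun u => (u + - (INR N * x)) ^ 2)), coin_square.
    unfold K. ring. }
  assert (HK : K <= e).
  { apply (Rle_trans _ (L / 2 * d + L / 2 * d)).
    - unfold K. apply Rplus_le_compat_l.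
      replace (L / (2 * d * INR N ^ 2) * (INR N * (1 - x ^ 2)))
        with (L / 2 * ((1 - x ^ 2) / (d * INR N))) by (field; lra).
      apply Rmult_le_compat_l; [lra|].
      apply (Rmult_le_reg_r (d * INR N)); [nra|].
      replace ((1 - x ^ 2) / (d * INR N) * (d * INR N)) with (1 - x ^ 2)
        by (field; lra).
      assert (1 < d * d * INR N).
      { apply (Rmult_lt_reg_l (/ (d * d))); [apply Rinv_0_lt_compat; nra|].
        replace (/ (d * d) * (d * d * INR N)) with (INR N) by (field; lra). lra. }
      nra.
    - unfold d.
      replace (L / 2 * (e / (2 * (L + 1))) + L / 2 * (e / (2 * (L + 1))))
        with (e * (L / (2 * (L + 1)))) by (field; lra).
      assert (L / (2 * (L + 1)) <= 1).
      { apply (Rmult_le_reg_r (2 * (L + 1))); [lra|].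
        replace (L / (2 * (L + 1)) * (2 * (L + 1))) with L by (field; lra). lra. }
      nra. }
  apply Rabs_le_between. split.
  - assert (coin N (fun u => - g x + -1 * g (u / INR N) + 2 * g x) x <= K).
    { rewrite <- HE. apply coin_le; [lra|]. intros u.
      specialize (Hpt u). apply Rabs_le_between in Hpt. lra. }
    rewrite (coin_ext N x _ (fun u => g x + -1 * g (u / INR N))) in H
      by (intros; ring).
    rewrite (coin_affine N x (g x) (-1) (fun u => g (u / INR N))) in H. lra.
  - assert (coin N (fun u => - g x + 1 * g (u / INR N)) x <= K).
    { rewrite <- HE. apply coin_le; [lra|]. intros u.
      specialize (Hpt u). apply Rabs_le_between in Hpt. lra. }
    rewrite (coin_affine N x (- g x) 1 (fun u => g (u / INR N))) in H. lra.
Qed.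

(** * The walk and its Fourier transform *)

Definition cosum (M : nat) (f : Z -> R) (k : R) : R :=
  window_sum M (fun t => f t * cos (k * IZR t)).
Definition sisum (M : nat) (f : Z -> R) (k : R) : R :=
  window_sum M (fun t => f t * sin (k * IZR t)).

Lemma cosum_shift_down M f k :
  f (Z.of_nat M) = 0 -> f (- Z.of_nat M - 1)%Z = 0 ->
  cosum M (fun t => f (t - 1)%Z) k = cos k * cosum M f k - sin k * sisum M f k.
Proof.
  intros H1 H2. unfold cosum, sisum.
  rewrite <- (window_sum_shift_down M (fun t => f t * cos _)) by (rewrite ?H1, ?H2; ring).
  rewrite <- (window_sum_shift_down M (fun t => f t * sin _)) by (rewrite ?H1, ?H2; ring).
  unfold window_sum, Rminus. rewrite Ropp_mult_distr_l, <- !zsum_scal.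
  rewrite <- zsum_plus. apply zsum_ext. intros t _.
  replace (k * IZR t) with (k * IZR (t - 1) + k)
    by (rewrite minus_IZR; ring).
  rewrite cos_plus. ring.
Qed.

Lemma sisum_shift_down M f k :
  f (Z.of_nat M) = 0 -> f (- Z.of_nat M - 1)%Z = 0 ->
  sisum M (fun t => f (t - 1)%Z) k = cos k * sisum M f k + sin k * cosum M f k.
Proof.
  intros H1 H2. unfold cosum, sisum.
  rewrite <- (window_sum_shift_down M (fun t => f t * cos _)) by (rewrite ?H1, ?H2; ring).
  rewrite <- (window_sum_shift_down M (fun t => f t * sin _)) by (rewrite ?H1, ?H2; ring).
  unfold window_sum. rewrite <- !zsum_scal.
  rewrite <- zsum_plus. apply zsum_ext. intros t _.
  replace (k * IZR t) with (k * IZR (t - 1) + k)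
    by (rewrite minus_IZR; ring).
  rewrite sin_plus. ring.
Qed.

Lemma cosum_shift_up M f k :
  f (- Z.of_nat M)%Z = 0 -> f (Z.of_nat M + 1)%Z = 0 ->
  cosum M (fun t => f (t + 1)%Z) k = cos k * cosum M f k + sin k * sisum M f k.
Proof.
  intros H1 H2. unfold cosum, sisum.
  rewrite <- (window_sum_shift_up M (fun t => f t * cos _)) by (rewrite ?H1, ?H2; ring).
  rewrite <- (window_sum_shift_up M (fun t => f t * sin _)) by (rewrite ?H1, ?H2; ring).
  unfold window_sum. rewrite <- !zsum_scal.
  rewrite <- zsum_plus. apply zsum_ext. intros t _.
  replace (k * IZR t) with (k * IZR (t + 1) - k)
    by (rewrite plus_IZR; ring).
  rewrite cos_minus. ring.
Qed.

Lemma sisum_shift_up M f k :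
  f (- Z.of_nat M)%Z = 0 -> f (Z.of_nat M + 1)%Z = 0 ->
  sisum M (fun t => f (t + 1)%Z) k = cos k * sisum M f k - sin k * cosum M f k.
Proof.
  intros H1 H2. unfold cosum, sisum.
  rewrite <- (window_sum_shift_up M (fun t => f t * cos _)) by (rewrite ?H1, ?H2; ring).
  rewrite <- (window_sum_shift_up M (fun t => f t * sin _)) by (rewrite ?H1, ?H2; ring).
  unfold window_sum, Rminus. rewrite Ropp_mult_distr_l, <- !zsum_scal.
  rewrite <- zsum_plus. apply zsum_ext. intros t _.
  replace (k * IZR t) with (k * IZR (t + 1) - k)
    by (rewrite plus_IZR; ring).
  rewrite sin_minus. ring.
Qed.

Lemma cosum_lin M f g x y k :
  cosum M (fun t => x * f t + y * g t) k = x * cosum M f k + y * cosum M g k.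
Proof.
  unfold cosum, window_sum. rewrite <- !zsum_scal, <- zsum_plus.
  apply zsum_ext. intros t _. ring.
Qed.

Lemma sisum_lin M f g x y k :
  sisum M (fun t => x * f t + y * g t) k = x * sisum M f k + y * sisum M g k.
Proof.
  unfold sisum, window_sum. rewrite <- !zsum_scal, <- zsum_plus.
  apply zsum_ext. intros t _. ring.
Qed.

Lemma is_RInt_cos_freq (m : Z) :
  is_RInt (fun k => cos (k * IZR m)) (- PI) PI (if Z.eqb m 0 then 2 * PI else 0).
Proof.
  destruct (Z.eqb_spec m 0) as [->|Hm].
  - apply (is_RInt_ext (fun _ => 1)).
    + intros x _. now rewrite Rmult_0_r, cos_0.
    + evar_last; [apply (is_RInt_const (V := R_NormedModule))|].
      unfold scal; simpl; unfold mult; simpl; ring.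
  - assert (Hm' : IZR m <> 0) by now apply not_0_IZR.
    evar_last.
    + apply (is_RInt_derive (V := R_CompleteNormedModule)
        (fun k => sin (k * IZR m) / IZR m) (fun k => cos (k * IZR m))).
      * intros x _. auto_derive; [exact I|]. field. exact Hm'.
      * intros x _. apply (ex_derive_continuous (V := R_NormedModule)).
        auto_derive. exact I.
    + unfold minus, plus, opp; simpl.
      replace (- PI * IZR m) with (- (PI * IZR m)) by ring.
      rewrite sin_neg.
      replace (PI * IZR m) with (IZR m * PI) by ring.
      rewrite (sin_eq_0_1 (IZR m * PI)) by (now exists m). field. exact Hm'.
Qed.

Lemma is_RInt_sin_freq (m : Z) :
  is_RInt (fun k => sin (k * IZR m)) (- PI) PI 0.
Proof.
  destruct (Z.eq_dec m 0) as [->|Hm].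
  - apply (is_RInt_ext (fun _ => 0)).
    + intros x _. now rewrite Rmult_0_r, sin_0.
    + evar_last; [apply (is_RInt_const (V := R_NormedModule))|].
      unfold scal; simpl; unfold mult; simpl; ring.
  - assert (Hm' : IZR m <> 0) by now apply not_0_IZR.
    evar_last.
    + apply (is_RInt_derive (V := R_CompleteNormedModule)
        (fun k => - cos (k * IZR m) / IZR m) (fun k => sin (k * IZR m))).
      * intros x _. auto_derive; [exact I|]. field. exact Hm'.
      * intros x _. apply (ex_derive_continuous (V := R_NormedModule)).
        auto_derive. exact I.
    + unfold minus, plus, opp; simpl.
      replace (- PI * IZR m) with (- (PI * IZR m)) by ring.
      rewrite cos_neg. field. exact Hm'.
Qed.

Lemma zsum_delta (f : Z -> R) (x : R) t len : forall a,
  (a <= t < a + Z.of_nat len)%Z ->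
  zsum (fun u => f u * (if Z.eqb (u - t) 0 then x else 0)) a len = f t * x.
Proof.
  induction len as [|l IH]; intros a H; [lia|]. simpl.
  destruct (Z.eqb_spec (a - t) 0) as [E|E].
  - replace a with t by lia. rewrite zsum_zero; [ring|].
    intros u Hu. destruct (Z.eqb_spec (u - t) 0); [lia|ring].
  - rewrite IH by lia. ring.
Qed.

Lemma fourier_coef_re M f t :
  (- Z.of_nat M <= t <= Z.of_nat M)%Z ->
  is_RInt (fun k => cos (k * IZR t) * cosum M f k + sin (k * IZR t) * sisum M f k)
    (- PI) PI (2 * PI * f t).
Proof.
  intros Ht. rewrite (Rmult_comm _ (f t)), <- (zsum_delta f (2 * PI) t (2 * M + 1) (- Z.of_nat M)) by lia.
  apply (is_RInt_ext (fun k => zsum (fun u => f u * cos (k * IZR (u - t)))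
    (- Z.of_nat M) (2 * M + 1))).
  - intros k _. unfold cosum, sisum, window_sum. rewrite <- !zsum_scal, <- zsum_plus.
    apply zsum_ext. intros u _. rewrite minus_IZR, Rmult_minus_distr_l, cos_minus.
    ring.
  - apply (is_RInt_zsum (fun u k => f u * cos (k * IZR (u - t)))).
    intros u _. apply (is_RInt_scal (V := R_NormedModule)), is_RInt_cos_freq.
Qed.

Lemma fourier_coef_im M f t :
  is_RInt (fun k => cos (k * IZR t) * sisum M f k - sin (k * IZR t) * cosum M f k)
    (- PI) PI 0.
Proof.
  replace 0 with (zsum (fun u => f u * 0) (- Z.of_nat M) (2 * M + 1))
    by (apply zsum_zero; intros; ring).
  apply (is_RInt_ext (fun k => zsum (fun u => f u * sin (k * IZR (u - t)))
    (- Z.of_nat M) (2 * M + 1))).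
  - intros k _. unfold cosum, sisum, window_sum, Rminus.
    rewrite Ropp_mult_distr_l, <- !zsum_scal, <- zsum_plus.
    apply zsum_ext. intros u _. rewrite minus_IZR, Rmult_minus_distr_l, sin_minus.
    ring.
  - apply (is_RInt_zsum (fun u k => f u * sin (k * IZR (u - t)))).
    intros u _. apply (is_RInt_scal (V := R_NormedModule)), is_RInt_sin_freq.
Qed.

(** The amplitudes at time [n] and position [t], in the two chiralities, of the
    walk whose one-step matrix is [e^theta B(k)] in momentum space: the inverse
    Fourier transform of the first row of its [n]-th power.  They are real. *)
Fixpoint walk (c s : R) (n : nat) : (Z -> R) * (Z -> R) :=
  match n with
  | O => (fun t => if Z.eqb t 0 then 1 else 0, fun _ => 0)
  | S n =>
      let (A, B) := walk c s n in
      (fun t => c * A (t - 1)%Z + - s * B (t + 1)%Z,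
       fun t => s * A (t - 1)%Z + c * B (t + 1)%Z)
  end.

Definition ampA c s n := fst (walk c s n).
Definition ampB c s n := snd (walk c s n).

Lemma walk_S c s n :
  walk c s (S n) =
  (fun t => c * ampA c s n (t - 1)%Z + - s * ampB c s n (t + 1)%Z,
   fun t => s * ampA c s n (t - 1)%Z + c * ampB c s n (t + 1)%Z).
Proof. unfold ampA, ampB. simpl. now destruct (walk c s n). Qed.

Lemma ampA_S c s n t :
  ampA c s (S n) t = c * ampA c s n (t - 1)%Z + - s * ampB c s n (t + 1)%Z.
Proof. unfold ampA at 1. now rewrite walk_S. Qed.

Lemma ampB_S c s n t :
  ampB c s (S n) t = s * ampA c s n (t - 1)%Z + c * ampB c s n (t + 1)%Z.
Proof. unfold ampB at 1. now rewrite walk_S. Qed.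

Lemma walk_support c s n : forall t,
  (t < - Z.of_nat n \/ Z.of_nat n < t)%Z ->
  ampA c s n t = 0 /\ ampB c s n t = 0.
Proof.
  induction n as [|n IH]; intros t Ht.
  - split; [|reflexivity]. unfold ampA. simpl. destruct (Z.eqb_spec t 0); [lia|reflexivity].
  - destruct (IH (t - 1)%Z) as [HA _]; [lia|]. destruct (IH (t + 1)%Z) as [_ HB]; [lia|].
    rewrite ampA_S, ampB_S, HA, HB. split; ring.
Qed.

Section WalkSums.
Variables c s k : R.
Variables n M : nat.
Hypothesis HnM : (S n <= M)%nat.

Local Ltac supp := match goal with
  | |- ampA c s n ?t = 0 => destruct (walk_support c s n t) as [H _]; [lia|exact H]
  | |- ampB c s n ?t = 0 => destruct (walk_support c s n t) as [_ H]; [lia|exact H]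
  end.

Lemma cosum_ampA_S : cosum M (ampA c s (S n)) k =
  c * (cos k * cosum M (ampA c s n) k - sin k * sisum M (ampA c s n) k)
  + - s * (cos k * cosum M (ampB c s n) k + sin k * sisum M (ampB c s n) k).
Proof.
  rewrite <- cosum_shift_down by supp. rewrite <- cosum_shift_up by supp.
  rewrite <- cosum_lin. apply zsum_ext. intros t _. now rewrite ampA_S.
Qed.

Lemma sisum_ampA_S : sisum M (ampA c s (S n)) k =
  c * (cos k * sisum M (ampA c s n) k + sin k * cosum M (ampA c s n) k)
  + - s * (cos k * sisum M (ampB c s n) k - sin k * cosum M (ampB c s n) k).
Proof.
  rewrite <- sisum_shift_down by supp. rewrite <- sisum_shift_up by supp.
  rewrite <- sisum_lin. apply zsum_ext. intros t _. now rewrite ampA_S.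
Qed.

Lemma cosum_ampB_S : cosum M (ampB c s (S n)) k =
  s * (cos k * cosum M (ampA c s n) k - sin k * sisum M (ampA c s n) k)
  + c * (cos k * cosum M (ampB c s n) k + sin k * sisum M (ampB c s n) k).
Proof.
  rewrite <- cosum_shift_down by supp. rewrite <- cosum_shift_up by supp.
  rewrite <- cosum_lin. apply zsum_ext. intros t _. now rewrite ampB_S.
Qed.

Lemma sisum_ampB_S : sisum M (ampB c s (S n)) k =
  s * (cos k * sisum M (ampA c s n) k + sin k * cosum M (ampA c s n) k)
  + c * (cos k * sisum M (ampB c s n) k - sin k * cosum M (ampB c s n) k).
Proof.
  rewrite <- sisum_shift_down by supp. rewrite <- sisum_shift_up by supp.
  rewrite <- sisum_lin. apply zsum_ext. intros t _. now rewrite ampB_S.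
Qed.
End WalkSums.

Lemma walk_sums_0 c s k M :
  cosum M (ampA c s 0) k = 1 /\ sisum M (ampA c s 0) k = 0 /\
  cosum M (ampB c s 0) k = 0 /\ sisum M (ampB c s 0) k = 0.
Proof.
  unfold cosum, sisum, window_sum, ampA, ampB; simpl walk; cbv [fst snd].
  repeat split.
  - transitivity (zsum (fun u => cos (k * IZR u) * (if (u - 0 =? 0)%Z then 1 else 0))
      (- Z.of_nat M) (2 * M + 1)).
    + apply zsum_ext. intros t _. rewrite Z.sub_0_r. ring.
    + rewrite (zsum_delta (fun t => cos (k * IZR t))) by lia.
      rewrite Rmult_0_r, cos_0. ring.
  - apply zsum_zero. intros t _. destruct (Z.eqb_spec t 0) as [->|_]; [|ring].
    rewrite Rmult_0_r, sin_0. ring.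
  - apply zsum_zero. intros; ring.
  - apply zsum_zero. intros; ring.
Qed.

Section Phase.
Variables c s : R.
Hypothesis Hcs : c ^ 2 + s ^ 2 = 1.
Hypothesis Hs : s <> 0.

(** The eigenvalues of the one-step matrix are [exp (i phase)] and
    [exp (- i phase)]; [vel], the derivative of [phase], is the group velocity. *)
Definition phase (k : R) : R := acos (c * cos k).
Definition csc_phase (k : R) : R := / sqrt (1 - (c * cos k) ^ 2).
Definition vel (k : R) : R := c * sin k * csc_phase k.

Lemma ccos_lt k : (c * cos k) ^ 2 < 1.
Proof.
  assert (0 < s ^ 2) by (apply pow2_gt_0, Hs).
  assert (cos k ^ 2 <= 1) by (pose proof (sin2_cos2 k); unfold Rsqr in *; nra).
  pose proof (pow2_ge_0 c). nra.
Qed.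

Lemma ccos_bounds k : -1 < c * cos k < 1.
Proof. pose proof (ccos_lt k). nra. Qed.

Lemma csc_phase_pos k : 0 < csc_phase k.
Proof.
  apply Rinv_0_lt_compat, sqrt_lt_R0. pose proof (ccos_lt k). lra.
Qed.

Lemma csc_phase_sqr k : csc_phase k ^ 2 * (1 - (c * cos k) ^ 2) = 1.
Proof.
  unfold csc_phase. pose proof (ccos_lt k).
  assert (0 < sqrt (1 - (c * cos k) ^ 2)) by (apply sqrt_lt_R0; lra).
  rewrite <- (sqrt_sqrt (1 - (c * cos k) ^ 2)) at 2 by lra. field. lra.
Qed.

Lemma cos_phase k : cos (phase k) = c * cos k.
Proof. apply cos_acos. pose proof (ccos_bounds k). lra. Qed.

Lemma sin_phase k : sin (phase k) * csc_phase k = 1.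
Proof.
  unfold phase. rewrite sin_acos by (pose proof (ccos_bounds k); lra).
  unfold csc_phase. rewrite Rsqr_pow2. field. pose proof (csc_phase_pos k). unfold csc_phase in *.
  pose proof (ccos_lt k).
  assert (0 < sqrt (1 - (c * cos k) ^ 2)) by (apply sqrt_lt_R0; lra). lra.
Qed.

Lemma sin_phase_eq k : sin (phase k) = (1 - (c * cos k) ^ 2) * csc_phase k.
Proof.
  pose proof (sin_phase k). pose proof (csc_phase_sqr k). pose proof (csc_phase_pos k).
  apply (Rmult_eq_reg_r (csc_phase k)); [|lra]. rewrite H. nra.
Qed.

Lemma is_derive_csc_phase (k : R) :
  is_derive csc_phase k (- c ^ 2 * (cos k * (sin k * (csc_phase k * (csc_phase k * csc_phase k))))).
Proof.
  pose proof (ccos_lt k).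
  assert (0 < sqrt (1 - (c * cos k) ^ 2)) by (apply sqrt_lt_R0; lra).
  unfold csc_phase. auto_derive.
  - replace (1 + - (c * cos k * (c * cos k * 1))) with (1 - (c * cos k) ^ 2) by ring.
    replace (1 - c * cos k * (c * cos k * 1)) with (1 - (c * cos k) ^ 2) by ring.
    repeat split; first [lra | apply Rgt_not_eq; lra].
  - replace (1 + - (c * cos k * (c * cos k * 1))) with (1 - (c * cos k) ^ 2) by ring.
    set (q := sqrt (1 - (c * cos k) ^ 2)) in *. field. lra.
Qed.

Lemma is_derive_phase (k : R) : is_derive phase k (vel k).
Proof.
  pose proof (ccos_bounds k) as Hb.
  assert (H : is_derive acos (c * cos k) (- csc_phase k)).
  { apply is_derive_Reals.
    assert (E := derive_pt_acos (c * cos k) Hb).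
    destruct (derivable_pt_acos (c * cos k) Hb) as [l Hl]. simpl in E.
    replace (- csc_phase k) with l; [exact Hl|].
    unfold derive_pt in E; simpl in E. rewrite E. unfold csc_phase. rewrite Rsqr_pow2.
    field. pose proof (csc_phase_pos k). unfold csc_phase in *. intros E0. rewrite E0, Rinv_0 in *. lra. }
  unfold phase.
  evar_last.
  - apply (is_derive_comp (V := R_NormedModule) acos (fun k => c * cos k) k); [exact H|].
    auto_derive; [exact I|reflexivity].
  - unfold scal; simpl; unfold mult; simpl. unfold vel. ring.
Qed.

(** With [phi] the phase, the [n]-th power of the one-step matrix is
    [cos (n phi) + i sin (n phi) N] for a matrix [N] with square 1. *)
Lemma walk_sums_closed k n M : (n <= M)%nat ->
  cosum M (ampA c s n) k = cos (INR n * phase k) /\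
  sisum M (ampA c s n) k = vel k * sin (INR n * phase k) /\
  cosum M (ampB c s n) k = s * csc_phase k * cos k * sin (INR n * phase k) /\
  sisum M (ampB c s n) k = s * csc_phase k * sin k * sin (INR n * phase k).
Proof.
  induction n as [|n IH]; intros HM.
  - destruct (walk_sums_0 c s k M) as (-> & -> & -> & ->).
    simpl. rewrite Rmult_0_l, cos_0, sin_0. repeat split; ring.
  - destruct IH as (H1 & H2 & H3 & H4); [lia|].
    rewrite cosum_ampA_S, sisum_ampA_S, cosum_ampB_S, sisum_ampB_S by lia.
    rewrite H1, H2, H3, H4, S_INR, Rmult_plus_distr_r, Rmult_1_l.
    rewrite cos_plus, sin_plus, cos_phase, sin_phase_eq. unfold vel.
    pose proof (csc_phase_sqr k) as HI.
    pose proof (sin2_cos2 k) as Hk. unfold Rsqr in Hk.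
    assert (Hs2 : s ^ 2 = 1 - c ^ 2) by lra.
    assert (Hk2 : sin k ^ 2 = 1 - cos k ^ 2) by lra.
    set (ck := cos k) in *. set (sk := sin k) in *. set (i := csc_phase k) in *.
    set (C := cos (INR n * phase k)). set (S := sin (INR n * phase k)).
    repeat split.
    + replace (c * (ck * C - sk * (c * sk * i * S)) +
        - s * (ck * (s * i * ck * S) + sk * (s * i * sk * S))) with
        (c * ck * C - i * S * (c ^ 2 * sk ^ 2 + s ^ 2 * ck ^ 2 + s ^ 2 * sk ^ 2)) by ring.
      rewrite Hs2, Hk2. ring.
    + replace (c * sk * i * (S * (c * ck) + C * ((1 - (c * ck) ^ 2) * i))) with
        (c ^ 2 * sk * i * S * ck + c * sk * C * (i ^ 2 * (1 - (c * ck) ^ 2))) by ring.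
      rewrite HI. ring.
    + replace (s * i * ck * (S * (c * ck) + C * ((1 - (c * ck) ^ 2) * i))) with
        (s * i * ck * S * c * ck + s * ck * C * (i ^ 2 * (1 - (c * ck) ^ 2))) by ring.
      rewrite HI. ring.
    + replace (s * i * sk * (S * (c * ck) + C * ((1 - (c * ck) ^ 2) * i))) with
        (s * i * sk * S * c * ck + s * sk * C * (i ^ 2 * (1 - (c * ck) ^ 2))) by ring.
      rewrite HI. ring.
Qed.

Lemma vel_identities k :
  (s * csc_phase k) ^ 2 = 1 - vel k ^ 2 /\ -1 < vel k < 1 /\ c ^ 2 - vel k ^ 2 = (c * s * csc_phase k * cos k) ^ 2.
Proof.
  pose proof (csc_phase_sqr k) as HI.
  pose proof (sin2_cos2 k) as Hk. unfold Rsqr in Hk.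
  assert (E : (s * csc_phase k) ^ 2 = 1 - vel k ^ 2).
  { unfold vel. replace (1 - (c * sin k * csc_phase k) ^ 2) with (1 - c ^ 2 * sin k ^ 2 * csc_phase k ^ 2) by ring.
    rewrite <- HI at 1. replace (sin k ^ 2) with (1 - cos k ^ 2) by lra.
    replace ((s * csc_phase k) ^ 2) with (s ^ 2 * csc_phase k ^ 2) by ring.
    replace (s ^ 2) with (1 - c ^ 2) by lra. ring. }
  split; [exact E|]. split.
  - assert (0 < (s * csc_phase k) ^ 2).
    { apply pow2_gt_0. pose proof (csc_phase_pos k). apply Rmult_integral_contrapositive. split; lra. }
    nra.
  - unfold vel. replace (c ^ 2 - (c * sin k * csc_phase k) ^ 2) with (c ^ 2 * 1 - c ^ 2 * sin k ^ 2 * csc_phase k ^ 2) by ring.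
    rewrite <- HI. replace (sin k ^ 2) with (1 - cos k ^ 2) by lra.
    replace ((c * s * csc_phase k * cos k) ^ 2) with (c ^ 2 * s ^ 2 * csc_phase k ^ 2 * cos k ^ 2) by ring.
    replace (s ^ 2) with (1 - c ^ 2) by lra. ring.
Qed.

End Phase.

(** * Oscillatory integrals *)

Lemma lim_seq_eps (u : nat -> R) (l : R) :
  is_lim_seq u l <->
  forall e, 0 < e -> exists N, forall n, (N <= n)%nat -> Rabs (u n - l) < e.
Proof.
  rewrite <- is_lim_seq_spec. split.
  - intros H e He. exact (H (mkposreal e He)).
  - intros H e. exact (H e (cond_pos e)).
Qed.

Lemma lim_inv_INR K : is_lim_seq (fun n => K / INR n) 0.
Proof.
  replace (Finite 0) with (Rbar_mult K 0) by (simpl; f_equal; ring).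
  apply (is_lim_seq_ext (fun n => K * / INR n)); [reflexivity|].
  apply is_lim_seq_scal_l.
  replace (Finite 0) with (Rbar_inv p_infty) by reflexivity.
  apply is_lim_seq_inv; [apply is_lim_seq_INR|discriminate].
Qed.

Lemma lim_dominated (u : nat -> R) (l K : R) :
  (forall n, (1 <= n)%nat -> Rabs (u n - l) <= K / INR n) -> is_lim_seq u l.
Proof.
  intros H. apply lim_seq_eps. intros e He.
  destruct (proj1 (lim_seq_eps _ _) (lim_inv_INR K) e He) as [N HN].
  exists (S N). intros n Hn. eapply Rle_lt_trans; [apply H; lia|].
  specialize (HN n). rewrite Rminus_0_r in HN.
  eapply Rle_lt_trans; [apply Rle_abs|]. apply HN. lia.
Qed.

Lemma RInt_abs_le_const (f : R -> R) a b K : a <= b -> ex_RInt f a b ->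
  (forall x, a <= x <= b -> Rabs (f x) <= K) ->
  Rabs (RInt f a b) <= (b - a) * K.
Proof.
  intros Hab Hf HK.
  apply (norm_RInt_le_const (V := R_NormedModule) f a b (RInt f a b) K Hab HK).
  apply (RInt_correct (V := R_CompleteNormedModule)), Hf.
Qed.

Lemma ex_RInt_cont (f : R -> R) a b :
  (forall x, continuous f x) -> ex_RInt f a b.
Proof. intros H. apply (ex_RInt_continuous (V := R_CompleteNormedModule)). auto. Qed.

Lemma RInt_Rext (f g : R -> R) a b :
  (forall x, Rmin a b < x < Rmax a b -> f x = g x) -> RInt f a b = RInt g a b.
Proof. exact (RInt_ext (V := R_CompleteNormedModule) f g a b). Qed.

Lemma RInt_Rplus (f g : R -> R) a b : ex_RInt f a b -> ex_RInt g a b ->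
  RInt (fun x => f x + g x) a b = RInt f a b + RInt g a b.
Proof. exact (RInt_plus (V := R_CompleteNormedModule) f g a b). Qed.

Lemma RInt_Rminus (f g : R -> R) a b : ex_RInt f a b -> ex_RInt g a b ->
  RInt (fun x => f x - g x) a b = RInt f a b - RInt g a b.
Proof. exact (RInt_minus (V := R_CompleteNormedModule) f g a b). Qed.

Lemma RInt_Rscal (f : R -> R) a b x : ex_RInt f a b ->
  RInt (fun y => x * f y) a b = x * RInt f a b.
Proof. exact (RInt_scal (V := R_CompleteNormedModule) f a b x). Qed.

Lemma RInt_split (f : R -> R) a b d : (forall x, continuous f x) ->
  RInt f a d = RInt f a b + RInt f b d.
Proof.
  intros H. symmetry.
  apply (RInt_Chasles (V := R_CompleteNormedModule)); apply ex_RInt_cont, H.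
Qed.

(** The integrals near the end points are small uniformly in the sequence, by
    boundedness; this is what allows stationary points of a phase to be cut off. *)
Lemma lim_RInt_interior (f : nat -> R -> R) a b K : a < b ->
  (forall n x, continuous (f n) x) ->
  (forall n x, Rabs (f n x) <= K) ->
  (forall a' b', a < a' -> a' < b' -> b' < b ->
     is_lim_seq (fun n => RInt (f n) a' b') 0) ->
  is_lim_seq (fun n => RInt (f n) a b) 0.
Proof.
  intros Hab Hc HK H. apply lim_seq_eps. intros e He.
  assert (HK0 : 0 <= K) by (eapply Rle_trans; [apply Rabs_pos|apply (HK O 0)]).
  (* Each end piece of length [d] contributes at most [d K <= e / 4]. *)
  set (d := Rmin ((b - a) / 3) (e / (4 * (K + 1)))).
  assert (Hd1 : d <= (b - a) / 3) by apply Rmin_l.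
  assert (Hd2 : d <= e / (4 * (K + 1))) by apply Rmin_r.
  assert (Hd : 0 < d).
  { apply Rmin_glb_lt; [lra|]. apply Rdiv_lt_0_compat; lra. }
  assert (HdK : d * K <= e / 4).
  { apply (Rle_trans _ (e / (4 * (K + 1)) * (K + 1))); [nra|].
    right. field. lra. }
  destruct (proj1 (lim_seq_eps _ _) (H (a + d) (b - d) ltac:(lra) ltac:(lra) ltac:(lra))
              (e / 2) ltac:(lra)) as [N HN].
  exists N. intros n Hn. specialize (HN n Hn). rewrite Rminus_0_r in *.
  rewrite (RInt_split _ a (a + d) b), (RInt_split _ (a + d) (b - d) b) by auto.
  assert (H1 : Rabs (RInt (f n) a (a + d)) <= (a + d - a) * K)
    by (apply RInt_abs_le_const; [lra|apply ex_RInt_cont; auto|auto]).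
  assert (H2 : Rabs (RInt (f n) (b - d) b) <= (b - (b - d)) * K)
    by (apply RInt_abs_le_const; [lra|apply ex_RInt_cont; auto|auto]).
  apply Rabs_def2 in HN. apply Rabs_le_between in H1. apply Rabs_le_between in H2.
  apply Rabs_def1; nra.
Qed.

Section Amplitudes.
Variables c s : R.
Hypothesis Hcs : c ^ 2 + s ^ 2 = 1.
Hypothesis Hc : c <> 0.
Hypothesis Hs : s <> 0.

(** Polynomials in [h], [cos k], [sin k] and [1 / sin (phase k)]: an algebra of
    functions stable under differentiation in [k].  The variable [h] stands for
    the inverse of the time. *)
Inductive trig : Type :=
| Cst (x : R) | InvTime | CosK | SinK | CscPhase
| Add (e1 e2 : trig) | Mul (e1 e2 : trig).

Fixpoint eval (e : trig) (h k : R) : R :=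
  match e with
  | Cst x => x
  | InvTime => h
  | CosK => cos k
  | SinK => sin k
  | CscPhase => csc_phase c k
  | Add e1 e2 => eval e1 h k + eval e2 h k
  | Mul e1 e2 => eval e1 h k * eval e2 h k
  end.

Fixpoint diff (e : trig) : trig :=
  match e with
  | Cst _ | InvTime => Cst 0
  | CosK => Mul (Cst (-1)) SinK
  | SinK => CosK
  | CscPhase => Mul (Cst (- c ^ 2))
                 (Mul CosK (Mul SinK (Mul CscPhase (Mul CscPhase CscPhase))))
  | Add e1 e2 => Add (diff e1) (diff e2)
  | Mul e1 e2 => Add (Mul (diff e1) e2) (Mul e1 (diff e2))
  end.

Definition vel_trig : trig := Mul (Mul (Cst c) SinK) CscPhase.

Lemma is_derive_eval e h (k : R) : is_derive (eval e h) k (eval (diff e) h k).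
Proof.
  induction e as [x| | | | |e1 IH1 e2 IH2|e1 IH1 e2 IH2]; simpl.
  - apply (is_derive_const (K := R_AbsRing) (V := R_NormedModule)).
  - apply (is_derive_const (K := R_AbsRing) (V := R_NormedModule)).
  - auto_derive; [exact I|ring].
  - auto_derive; [exact I|ring].
  - apply is_derive_csc_phase with s; assumption.
  - apply (is_derive_plus (K := R_AbsRing) (V := R_NormedModule)); assumption.
  - apply (is_derive_mult (K := R_AbsRing) (eval e1 h) (eval e2 h)); try assumption.
    intros; apply Rmult_comm.
Qed.

Lemma continuous_eval e h (k : R) : continuous (eval e h) k.
Proof.
  apply (ex_derive_continuous (V := R_NormedModule)).
  eexists. apply is_derive_eval.
Qed.

Lemma csc_phase_le k : csc_phase c k <= / Rabs s.
Proof.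
  assert (0 < Rabs s) by now apply Rabs_pos_lt.
  pose proof (csc_phase_pos c s Hcs Hs k) as Hp.
  destruct (vel_identities c s Hcs Hs k) as [E _].
  apply (Rmult_le_reg_l (Rabs s)); [lra|].
  rewrite Rinv_r by lra.
  assert (Rabs s * csc_phase c k = Rabs (s * csc_phase c k))
    by (rewrite Rabs_mult, (Rabs_pos_eq (csc_phase c k)); lra).
  rewrite H0. apply Rabs_le. pose proof (pow2_ge_0 (vel c k)). nra.
Qed.

Lemma eval_bounded e : exists K, 0 <= K /\
  forall h k, Rabs h <= 1 -> Rabs (eval e h k) <= K.
Proof.
  induction e as [x| | | | |e1 [K1 [P1 H1]] e2 [K2 [P2 H2]]|e1 [K1 [P1 H1]] e2 [K2 [P2 H2]]]; simpl.
  - exists (Rabs x). split; [apply Rabs_pos|]. intros; lra.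
  - exists 1. split; [lra|]. auto.
  - exists 1. split; [lra|]. intros h k _. apply Rabs_le, COS_bound.
  - exists 1. split; [lra|]. intros h k _. apply Rabs_le, SIN_bound.
  - exists (/ Rabs s). split.
    { apply Rlt_le, Rinv_0_lt_compat, Rabs_pos_lt, Hs. }
    intros h k _. rewrite Rabs_pos_eq; [apply csc_phase_le|].
    apply Rlt_le, (csc_phase_pos c s Hcs Hs).
  - exists (K1 + K2). split; [lra|]. intros h k Hh.
    eapply Rle_trans; [apply Rabs_triang|]. apply Rplus_le_compat; auto.
  - exists (K1 * K2). split; [nra|]. intros h k Hh.
    rewrite Rabs_mult. apply Rmult_le_compat; auto using Rabs_pos.
Qed.

(** The terms carrying a factor [h] are of the order of the inverse of the time,
    uniformly in the momentum: only the value at [h = 0] survives in the limit. *)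
Lemma eval_near_0 e : exists K, 0 <= K /\
  forall h k, Rabs h <= 1 -> Rabs (eval e h k - eval e 0 k) <= K * Rabs h.
Proof.
  assert (H0 : Rabs 0 <= 1) by (rewrite Rabs_R0; lra).
  induction e as [x| | | | |e1 [K1 [P1 H1]] e2 [K2 [P2 H2]]|e1 [K1 [P1 H1]] e2 [K2 [P2 H2]]]; simpl.
  1, 3, 4, 5: exists 0; split; [lra|]; intros h k _; rewrite Rminus_diag, Rabs_R0; lra.
  - exists 1. split; [lra|]. intros h k _. rewrite Rminus_0_r. lra.
  - exists (K1 + K2). split; [lra|]. intros h k Hh.
    replace (eval e1 h k + eval e2 h k - (eval e1 0 k + eval e2 0 k))
      with ((eval e1 h k - eval e1 0 k) + (eval e2 h k - eval e2 0 k)) by ring.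
    eapply Rle_trans; [apply Rabs_triang|].
    specialize (H1 h k Hh). specialize (H2 h k Hh). lra.
  - destruct (eval_bounded e1) as [B1 [Q1 G1]].
    destruct (eval_bounded e2) as [B2 [Q2 G2]].
    exists (K1 * B2 + B1 * K2). split; [nra|]. intros h k Hh.
    replace (eval e1 h k * eval e2 h k - eval e1 0 k * eval e2 0 k)
      with ((eval e1 h k - eval e1 0 k) * eval e2 h k
            + eval e1 0 k * (eval e2 h k - eval e2 0 k)) by ring.
    eapply Rle_trans; [apply Rabs_triang|]. rewrite !Rabs_mult.
    specialize (H1 h k Hh). specialize (H2 h k Hh). specialize (G1 0 k H0).
    specialize (G2 h k Hh).
    replace ((K1 * B2 + B1 * K2) * Rabs h) with (K1 * Rabs h * B2 + B1 * (K2 * Rabs h)) by ring.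
    apply Rplus_le_compat; apply Rmult_le_compat; auto using Rabs_pos.
Qed.

Lemma continuous_wave e h N tau (k : R) :
  continuous (fun k => eval e h k * cos (N * phase c k + tau)) k.
Proof.
  apply (ex_derive_continuous (V := R_NormedModule)).
  auto_derive. repeat split.
  - eexists. apply is_derive_eval.
  - eexists. apply (is_derive_phase c s Hcs Hs).
Qed.

(** Where the group velocity does not vanish, integration by parts against
    [cos (N phase) = (sin (N phase))' / (N vel)] gains a factor [1 / N]. *)
Lemma wave_nonstationary e tau a b : a < b ->
  (forall k, a <= k <= b -> vel c k <> 0) ->
  is_lim_seq (fun n => RInt (fun k =>
    eval e 0 k * cos (2 * INR n * phase c k + tau)) a b) 0.
Proof.
  intros Hab Hv.
  set (g := fun k => eval e 0 k / eval vel_trig 0 k).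
  set (dg := fun k => (eval (diff e) 0 k * eval vel_trig 0 k
                       - eval e 0 k * eval (diff vel_trig) 0 k) / eval vel_trig 0 k ^ 2).
  assert (Hvel : forall k, eval vel_trig 0 k = vel c k) by reflexivity.
  assert (Hg : forall k : R, a <= k <= b -> is_derive g k (dg k)).
  { intros k Hk. apply is_derive_div; try apply is_derive_eval. now apply Hv. }
  assert (Hdg : forall k : R, a <= k <= b -> continuous dg k).
  { intros k Hk. unfold dg, Rdiv.
    apply (continuous_mult (K := R_AbsRing)).
    - apply (continuous_minus (V := R_NormedModule));
        apply (continuous_mult (K := R_AbsRing)); apply continuous_eval.
    - apply continuous_Rinv_comp; [|apply pow_nonzero; now apply Hv].
      apply (continuous_ext (eval (Mul vel_trig vel_trig) 0)); [|apply continuous_eval].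
      intros x. simpl. now rewrite Rmult_1_r. }
  assert (Hdga : ex_RInt (fun k => Rabs (dg k)) a b).
  { apply (ex_RInt_norm dg), (ex_RInt_continuous (V := R_CompleteNormedModule)).
    rewrite Rmin_left, Rmax_right by lra. exact Hdg. }
  set (J := RInt (fun k => Rabs (dg k)) a b).
  apply (lim_dominated _ 0 (Rabs (g a) + Rabs (g b) + J)).
  intros n Hn. rewrite Rminus_0_r.
  assert (Hn1 : 1 <= INR n) by (now apply (le_INR 1)).
  set (N := 2 * INR n). assert (HN : 0 < N) by (unfold N; lra).
  set (w := fun k => sin (N * phase c k + tau)).
  assert (Hw : forall k : R, is_derive w k (N * vel c k * cos (N * phase c k + tau))).
  { intros k. unfold w. auto_derive.
    - eexists. apply (is_derive_phase c s Hcs Hs).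
    - replace (Derive (fun x => phase c x) k) with (vel c k); [ring|].
      symmetry. apply is_derive_unique, (is_derive_phase c s Hcs Hs). }
  assert (Hcw : forall k : R, continuous w k).
  { intros k. apply (ex_derive_continuous (V := R_NormedModule)). eexists. apply Hw. }
  assert (I1 : is_RInt (fun k => dg k * w k + N * (eval e 0 k * cos (N * phase c k + tau)))
                 a b (g b * w b - g a * w a)).
  { apply (is_RInt_derive (V := R_CompleteNormedModule) (fun k => g k * w k)).
    - rewrite Rmin_left, Rmax_right by lra. intros k Hk.
      evar_last.
      + apply (is_derive_mult (K := R_AbsRing) g w); [now apply Hg|apply Hw|].
        intros; apply Rmult_comm.
      + unfold plus, mult; simpl. unfold g. rewrite Hvel. field. now apply Hv.
    - rewrite Rmin_left, Rmax_right by lra. intros k Hk.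
      apply (continuous_plus (V := R_NormedModule)).
      + apply (continuous_mult (K := R_AbsRing)); [now apply Hdg|apply Hcw].
      + apply (continuous_scal_r (V := R_NormedModule)), continuous_wave. }
  assert (X2 : ex_RInt (fun k => dg k * w k) a b).
  { apply (ex_RInt_continuous (V := R_CompleteNormedModule)).
    rewrite Rmin_left, Rmax_right by lra. intros k Hk.
    apply (continuous_mult (K := R_AbsRing)); [now apply Hdg|apply Hcw]. }
  assert (X3 : ex_RInt (fun k => eval e 0 k * cos (N * phase c k + tau)) a b)
    by (apply ex_RInt_cont; intros; apply continuous_wave).
  assert (E : RInt (fun k => dg k * w k) a b +
    N * RInt (fun k => eval e 0 k * cos (N * phase c k + tau)) a b
    = g b * w b - g a * w a).
  { rewrite <- (is_RInt_unique _ _ _ _ I1).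
    rewrite <- (RInt_Rscal _ _ _ _ X3). symmetry. apply RInt_Rplus; [exact X2|].
    apply (ex_RInt_scal (V := R_NormedModule)), X3. }
  assert (HJ : Rabs (RInt (fun k => dg k * w k) a b) <= J).
  { eapply Rle_trans; [apply abs_RInt_le; [lra|exact X2]|].
    apply RInt_le; [lra| |exact Hdga|].
    - exact (ex_RInt_norm _ _ _ X2).
    - intros k _. rewrite Rabs_mult.
      assert (Rabs (w k) <= 1) by (apply Rabs_le, SIN_bound).
      pose proof (Rabs_pos (dg k)). nra. }
  assert (Hwa : forall x y, Rabs (x * w y) <= Rabs x).
  { intros x y. rewrite Rabs_mult.
    assert (Rabs (w y) <= 1) by (apply Rabs_le, SIN_bound).
    pose proof (Rabs_pos x). nra. }
  pose proof (Hwa (g a) a) as Ha. pose proof (Hwa (g b) b) as Hb.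
  apply (Rmult_le_reg_l (INR n)); [lra|].
  replace (INR n * ((Rabs (g a) + Rabs (g b) + J) / INR n))
    with (Rabs (g a) + Rabs (g b) + J) by (field; lra).
  set (Q := RInt (fun k => eval e 0 k * cos (N * phase c k + tau)) a b) in *.
  assert (INR n * Rabs Q <= Rabs (N * Q)).
  { rewrite Rabs_mult, (Rabs_pos_eq N) by lra. unfold N.
    pose proof (Rabs_pos Q). nra. }
  eapply Rle_trans; [exact H|].
  replace (N * Q) with (g b * w b + - (g a * w a) + - RInt (fun k => dg k * w k) a b) by lra.
  eapply Rle_trans; [apply Rabs_triang|]. rewrite Rabs_Ropp.
  apply Rplus_le_compat; [|exact HJ].
  eapply Rle_trans; [apply Rabs_triang|]. rewrite Rabs_Ropp. lra.
Qed.

Lemma vel_neq_0 k : (- PI < k < 0 \/ 0 < k < PI) -> vel c k <> 0.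
Proof.
  intros Hk. pose proof (csc_phase_pos c s Hcs Hs k).
  assert (sin k <> 0).
  { destruct Hk as [Hk|Hk].
    - apply Rlt_not_eq, sin_lt_0_var; lra.
    - apply Rgt_not_eq, sin_gt_0; lra. }
  unfold vel. repeat (apply Rmult_integral_contrapositive; split); lra.
Qed.

(** The phase is stationary only at the multiples of [PI], which are end points
    of the two halves of the period. *)
Lemma wave_vanishes e tau : is_lim_seq (fun n => RInt (fun k =>
    eval e (/ INR n) k * cos (2 * INR n * phase c k + tau)) (- PI) PI) 0.
Proof.
  pose proof PI_RGT_0 as HPI.
  assert (H0 : is_lim_seq (fun n => RInt (fun k =>
    eval e 0 k * cos (2 * INR n * phase c k + tau)) (- PI) PI) 0).
  { destruct (eval_bounded e) as [K [HK HB]].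
    assert (HB0 : forall n k,
      Rabs (eval e 0 k * cos (2 * INR n * phase c k + tau)) <= K).
    { intros n k. rewrite Rabs_mult.
      assert (Rabs (eval e 0 k) <= K) by (apply HB; rewrite Rabs_R0; lra).
      assert (Rabs (cos (2 * INR n * phase c k + tau)) <= 1)
        by (apply Rabs_le, COS_bound).
      pose proof (Rabs_pos (eval e 0 k)). 
      pose proof (Rabs_pos (cos (2 * INR n * phase c k + tau))). nra. }
    apply (is_lim_seq_ext (fun n =>
      RInt (fun k => eval e 0 k * cos (2 * INR n * phase c k + tau)) (- PI) 0 +
      RInt (fun k => eval e 0 k * cos (2 * INR n * phase c k + tau)) 0 PI)).
    - intros n. symmetry. apply RInt_split. intros; apply continuous_wave.
    - evar_last; [apply (is_lim_seq_plus' _ _ 0 0)|now rewrite Rplus_0_r].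
      + apply lim_RInt_interior with K; auto; [lra|intros; apply continuous_wave|].
        intros a b H1 H2 H3. apply wave_nonstationary; [lra|].
        intros k Hk. apply vel_neq_0. lra.
      + apply lim_RInt_interior with K; auto; [intros; apply continuous_wave|].
        intros a b H1 H2 H3. apply wave_nonstationary; [lra|].
        intros k Hk. apply vel_neq_0. lra. }
  destruct (eval_near_0 e) as [K [HK HB]].
  apply (is_lim_seq_ext (fun n =>
    RInt (fun k => eval e 0 k * cos (2 * INR n * phase c k + tau)) (- PI) PI +
    (RInt (fun k => eval e (/ INR n) k * cos (2 * INR n * phase c k + tau)) (- PI) PI
     - RInt (fun k => eval e 0 k * cos (2 * INR n * phase c k + tau)) (- PI) PI)));
    [intros n; ring|].
  evar_last; [apply (is_lim_seq_plus' _ _ 0 0); [exact H0|]|now rewrite Rplus_0_r].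
  apply (lim_dominated _ 0 (2 * PI * K)). intros n Hn. rewrite Rminus_0_r.
  assert (Hn1 : 1 <= INR n) by (now apply (le_INR 1)).
  assert (Hi : 0 < / INR n) by (apply Rinv_0_lt_compat; lra).
  assert (Hi1 : / INR n <= 1) by (rewrite <- Rinv_1; apply Rinv_le_contravar; lra).
  rewrite <- RInt_Rminus
    by (apply ex_RInt_cont; intros; apply continuous_wave).
  replace (2 * PI * K / INR n) with ((PI - - PI) * (K / INR n)) by (field; lra).
  apply RInt_abs_le_const; [lra| |].
  - apply (ex_RInt_minus (V := R_NormedModule));
      apply ex_RInt_cont; intros; apply continuous_wave.
  - intros k _.
    set (w := cos (2 * INR n * phase c k + tau)).
    replace (eval e (/ INR n) k * w - eval e 0 k * w)
      with ((eval e (/ INR n) k - eval e 0 k) * w) by ring.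
    rewrite Rabs_mult.
    specialize (HB (/ INR n) k). rewrite (Rabs_pos_eq (/ INR n)) in HB by lra.
    specialize (HB Hi1).
    assert (Rabs w <= 1) by (apply Rabs_le, COS_bound).
    pose proof (Rabs_pos w). pose proof (Rabs_pos (eval e (/ INR n) k - eval e 0 k)).
    unfold Rdiv. nra.
Qed.

Lemma lim_RInt_eval e : is_lim_seq (fun n =>
  RInt (eval e (/ INR n)) (- PI) PI) (RInt (eval e 0) (- PI) PI).
Proof.
  pose proof PI_RGT_0 as HPI.
  destruct (eval_near_0 e) as [K [HK HB]].
  apply (lim_dominated _ _ (2 * PI * K)). intros n Hn.
  assert (Hn1 : 1 <= INR n) by (now apply (le_INR 1)).
  assert (Hi : 0 < / INR n) by (apply Rinv_0_lt_compat; lra).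
  assert (Hi1 : / INR n <= 1) by (rewrite <- Rinv_1; apply Rinv_le_contravar; lra).
  rewrite <- RInt_Rminus
    by (apply ex_RInt_cont; intros; apply continuous_eval).
  replace (2 * PI * K / INR n) with ((PI - - PI) * (K / INR n)) by (field; lra).
  apply RInt_abs_le_const; [lra| |].
  - apply (ex_RInt_minus (V := R_NormedModule));
      apply ex_RInt_cont; intros; apply continuous_eval.
  - intros k _. specialize (HB (/ INR n) k).
    rewrite (Rabs_pos_eq (/ INR n)) in HB by lra. apply HB, Hi1.
Qed.

(** Products of waves of frequency [n] average over the fast phase, since
    [cos^2 = (1 + cos (2 .)) / 2] and the like. *)
Lemma lim_RInt_wave_product p q p' q' :
  is_lim_seq (fun n => RInt (fun k =>
      (eval p (/ INR n) k * cos (INR n * phase c k)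
       + eval q (/ INR n) k * sin (INR n * phase c k)) *
      (eval p' (/ INR n) k * cos (INR n * phase c k)
       + eval q' (/ INR n) k * sin (INR n * phase c k))) (- PI) PI)
    (RInt (fun k => / 2 * (eval p 0 k * eval p' 0 k + eval q 0 k * eval q' 0 k)) (- PI) PI).
Proof.
  set (F := Mul (Cst (/ 2)) (Add (Mul p p') (Mul q q'))).
  set (G := Mul (Cst (/ 2)) (Add (Mul p p') (Mul (Cst (-1)) (Mul q q')))).
  set (H := Mul (Cst (/ 2)) (Add (Mul p q') (Mul q p'))).
  apply (is_lim_seq_ext (fun n => RInt (eval F (/ INR n)) (- PI) PI +
    (RInt (fun k => eval G (/ INR n) k * cos (2 * INR n * phase c k + 0)) (- PI) PI +
     RInt (fun k => eval H (/ INR n) k * cos (2 * INR n * phase c k + - (PI / 2))) (- PI) PI))).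
  - intros n.
    rewrite <- RInt_Rplus
      by (apply ex_RInt_cont; intros; apply continuous_wave).
    rewrite <- RInt_Rplus.
    + apply RInt_Rext. intros k _. simpl.
      rewrite Rplus_0_r.
      rewrite (Rmult_assoc 2).
      replace (2 * (INR n * phase c k) + - (PI / 2)) with (- (PI / 2 - 2 * (INR n * phase c k))) by ring.
      rewrite cos_neg, cos_shift, cos_2a, sin_2a.
      pose proof (sin2_cos2 (INR n * phase c k)) as HH. unfold Rsqr in HH.
      set (C := cos (INR n * phase c k)) in *. set (S := sin (INR n * phase c k)) in *.
      set (x := eval p (/ INR n) k). set (y := eval q (/ INR n) k).
      set (x' := eval p' (/ INR n) k). set (y' := eval q' (/ INR n) k).
      replace (/ 2 * (x * x' + y * y')) with (/ 2 * (x * x' + y * y') * (S * S + C * C))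
        by (rewrite HH; ring).
      field.
    + apply ex_RInt_cont; intros; apply continuous_eval.
    + apply (ex_RInt_plus (V := R_NormedModule));
        apply ex_RInt_cont; intros; apply continuous_wave.
  - evar_last.
    + apply is_lim_seq_plus'; [apply lim_RInt_eval|].
      apply is_lim_seq_plus'; apply wave_vanishes.
    + f_equal. rewrite Rplus_0_r, Rplus_0_r. reflexivity.
Qed.

End Amplitudes.

(** * Convergence of the moments *)

Lemma RInt_mirror (f : R -> R) p a b : (forall x, continuous f x) ->
  RInt (fun x => f (p - x)) a b = RInt f (p - b) (p - a).
Proof.
  intros Hf. apply is_RInt_unique.
  assert (H : is_RInt f (-1 * a + p) (-1 * b + p) (opp (RInt f (p - b) (p - a)))).
  { replace (-1 * a + p) with (p - a) by ring.
    replace (-1 * b + p) with (p - b) by ring.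
    apply (is_RInt_swap (V := R_NormedModule)).
    apply (RInt_correct (V := R_CompleteNormedModule)), ex_RInt_cont, Hf. }
  apply (is_RInt_comp_lin (V := R_NormedModule)) in H.
  apply (is_RInt_opp (V := R_NormedModule)) in H. rewrite opp_opp in H.
  apply (is_RInt_ext _ (fun x => f (p - x))) in H; [exact H|].
  intros x _. unfold opp, scal; simpl; unfold mult; simpl.
  replace (-1 * x + p) with (p - x) by ring. ring.
Qed.

(** The odd part of a function integrates to zero. *)
Lemma RInt_even_part (f g : R -> R) a :
  (forall x, continuous f x) -> (forall x, continuous g x) ->
  (forall x, f x + f (- x) = g x + g (- x)) ->
  RInt f (- a) a = RInt g (- a) a.
Proof.
  intros Hf Hg H.
  assert (Hr : forall h : R -> R, (forall x, continuous h x) ->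
    ex_RInt (fun x => h (- x)) (- a) a).
  { intros h Hh. apply ex_RInt_cont. intros x.
    apply (continuous_comp Ropp h); [|apply Hh].
    apply (continuous_opp (V := R_NormedModule)), continuous_id. }
  assert (E : RInt f (- a) a + RInt (fun x => f (- x)) (- a) a
            = RInt g (- a) a + RInt (fun x => g (- x)) (- a) a).
  { rewrite <- (RInt_Rplus f), <- (RInt_Rplus g)
      by solve [now apply ex_RInt_cont | now apply Hr].
    apply RInt_Rext. intros x _. apply H. }
  assert (M : forall h : R -> R, (forall x, continuous h x) ->
    RInt (fun x => h (- x)) (- a) a = RInt h (- a) a).
  { intros h Hh. rewrite (RInt_Rext _ (fun x => h (0 - x))) by (intros; f_equal; ring).
    rewrite RInt_mirror by exact Hh. f_equal; ring. }
  rewrite !M in E by assumption. lra.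
Qed.

(** The part of the limit density that depends on the initial superposition
    [al, be] of the two chiralities, as a function of the velocity. *)
Definition weight (c s al be v : R) : R :=
  al ^ 2 * (1 + v) ^ 2 + be ^ 2 * (1 - v ^ 2)
  + 2 * al * be * (s / c) * (v * (1 + v)).

Section Moments.
Variables c s : R.
Hypothesis Hcs : c ^ 2 + s ^ 2 = 1.
Hypothesis Hc : c <> 0.
Hypothesis Hs : s <> 0.
Variables al be : R.

Definition psi (n : nat) (t : Z) : R := al * ampA c s n t + be * ampB c s n t.

(** If [F + i G] is the Fourier series of [f], that of [t / n * f t] is
    [(G' - i F') / n].  When [F = p cos (n phi) + q sin (n phi)], the derivative
    [F' / n] has amplitudes [p' / n + vel q] and [q' / n - vel p]. *)
Definition deriv_wave (w : trig * trig) : trig * trig :=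
  let (p, q) := w in
  (Add (Mul InvTime (diff c p)) (Mul (vel_trig c) q),
   Add (Mul InvTime (diff c q)) (Mul (Cst (-1)) (Mul (vel_trig c) p))).

Definition opp_wave (w : trig * trig) : trig * trig :=
  (Mul (Cst (-1)) (fst w), Mul (Cst (-1)) (snd w)).

Fixpoint moment_wave (m : nat) : (trig * trig) * (trig * trig) :=
  match m with
  | O => ((Cst al, Mul (Cst (be * s)) (Mul CscPhase CosK)),
          (Cst 0, Add (Mul (Cst al) (vel_trig c)) (Mul (Cst (be * s)) (Mul CscPhase SinK))))
  | S m => let (re, im) := moment_wave m in (deriv_wave im, opp_wave (deriv_wave re))
  end.

Definition eval_wave (w : trig * trig) (n : nat) (k : R) : R :=
  eval c (fst w) (/ INR n) k * cos (INR n * phase c k)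
  + eval c (snd w) (/ INR n) k * sin (INR n * phase c k).

Lemma is_derive_eval_wave w n (k : R) : (1 <= n)%nat ->
  is_derive (eval_wave w n) k (INR n * eval_wave (deriv_wave w) n k).
Proof.
  intros Hn. destruct w as [p q]. unfold eval_wave. cbn [fst snd deriv_wave eval].
  assert (Hn1 : 0 < INR n) by (apply lt_0_INR; lia).
  assert (Hcos : is_derive (fun k => cos (INR n * phase c k)) k
    (- (INR n * vel c k) * sin (INR n * phase c k))).
  { auto_derive.
    - eexists. apply (is_derive_phase c s Hcs Hs).
    - replace (Derive (fun x => phase c x) k) with (vel c k); [ring|].
      symmetry. apply is_derive_unique, (is_derive_phase c s Hcs Hs). }
  assert (Hsin : is_derive (fun k => sin (INR n * phase c k)) k
    (INR n * vel c k * cos (INR n * phase c k))).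
  { auto_derive.
    - eexists. apply (is_derive_phase c s Hcs Hs).
    - replace (Derive (fun x => phase c x) k) with (vel c k); [ring|].
      symmetry. apply is_derive_unique, (is_derive_phase c s Hcs Hs). }
  evar_last.
  - apply (is_derive_plus (K := R_AbsRing) (V := R_NormedModule)).
    + apply (is_derive_mult (K := R_AbsRing) (eval c p (/ INR n)));
        [apply (is_derive_eval c s Hcs Hs)|exact Hcos|intros; apply Rmult_comm].
    + apply (is_derive_mult (K := R_AbsRing) (eval c q (/ INR n)));
        [apply (is_derive_eval c s Hcs Hs)|exact Hsin|intros; apply Rmult_comm].
  - unfold plus, mult; simpl. 
    change (c * sin k * csc_phase c k) with (vel c k). field. lra.
Qed.

Lemma is_derive_cosum M f k :
  is_derive (cosum M f) k (- sisum M (fun t => IZR t * f t) k).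
Proof.
  unfold cosum, sisum, window_sum.
  replace (- zsum (fun t => IZR t * f t * sin (k * IZR t)) (- Z.of_nat M) (2 * M + 1))
    with (zsum (fun t => -1 * (IZR t * f t * sin (k * IZR t))) (- Z.of_nat M) (2 * M + 1))
    by (rewrite zsum_scal; ring).
  apply (is_derive_zsum (fun t k => f t * cos (k * IZR t))
    (fun t k => -1 * (IZR t * f t * sin (k * IZR t)))).
  intros t. auto_derive; [exact I|ring].
Qed.

Lemma is_derive_sisum M f k :
  is_derive (sisum M f) k (cosum M (fun t => IZR t * f t) k).
Proof.
  unfold cosum, sisum, window_sum.
  apply (is_derive_zsum (fun t k => f t * sin (k * IZR t))
    (fun t k => IZR t * f t * cos (k * IZR t))).
  intros t. auto_derive; [exact I|ring].
Qed.

(** Differentiating the series term by term in [k] brings out the factor [t] that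
    leads from one moment to the next. *)
Lemma moment_wave_spec n m : (1 <= n)%nat -> forall k,
  cosum n (fun t => (IZR t / INR n) ^ m * psi n t) k
    = eval_wave (fst (moment_wave m)) n k /\
  sisum n (fun t => (IZR t / INR n) ^ m * psi n t) k
    = eval_wave (snd (moment_wave m)) n k.
Proof.
  intros Hn. assert (Hn1 : 0 < INR n) by (apply lt_0_INR; lia).
  induction m as [|m IH]; intros k.
  - destruct (walk_sums_closed c s Hcs Hs k n n (Nat.le_refl n)) as (H1 & H2 & H3 & H4).
    split.
    + transitivity (cosum n (fun t => al * ampA c s n t + be * ampB c s n t) k).
      { apply zsum_ext. intros t _. unfold psi. ring. }
      rewrite cosum_lin, H1, H3. unfold eval_wave. simpl. ring.
    + transitivity (sisum n (fun t => al * ampA c s n t + be * ampB c s n t) k).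
      { apply zsum_ext. intros t _. unfold psi. ring. }
      rewrite sisum_lin, H2, H4. unfold eval_wave. simpl.
      change (c * sin k * csc_phase c k) with (vel c k). ring.
  - set (f := fun t => (IZR t / INR n) ^ m * psi n t) in *.
    simpl moment_wave. destruct (moment_wave m) as [re im]. cbn [fst snd] in *.
    assert (E1 : forall k, cosum n (fun t => IZR t * f t) k
                   = INR n * eval_wave (deriv_wave im) n k).
    { intros x. rewrite <- (is_derive_unique _ _ _ (is_derive_sisum n f x)).
      apply is_derive_unique.
      apply (is_derive_ext (eval_wave im n)); [intros y; symmetry; apply IH|].
      now apply is_derive_eval_wave. }
    assert (E2 : forall k, - sisum n (fun t => IZR t * f t) k
                   = INR n * eval_wave (deriv_wave re) n k).
    { intros x. rewrite <- (is_derive_unique _ _ _ (is_derive_cosum n f x)).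
      apply is_derive_unique.
      apply (is_derive_ext (eval_wave re n)); [intros y; symmetry; apply IH|].
      now apply is_derive_eval_wave. }
    split.
    + apply (Rmult_eq_reg_l (INR n)); [|lra]. rewrite <- E1.
      unfold cosum, window_sum. rewrite <- zsum_scal. apply zsum_ext. intros t _.
      unfold f. simpl. field. lra.
    + apply (Rmult_eq_reg_l (INR n)); [|lra].
      replace (INR n * eval_wave (opp_wave (deriv_wave re)) n k)
        with (- (INR n * eval_wave (deriv_wave re) n k))
        by (unfold eval_wave; simpl; ring).
      rewrite <- E2, Ropp_involutive.
      unfold sisum, window_sum. rewrite <- zsum_scal. apply zsum_ext. intros t _.
      unfold f. simpl. field. lra.
Qed.

(** Integration term by term in the first series leaves the Fourier coefficients
    of the second. *)
Lemma parseval M f g :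
  RInt (fun k => cosum M f k * cosum M g k + sisum M f k * sisum M g k) (- PI) PI
  = 2 * PI * window_sum M (fun t => f t * g t).
Proof.
  apply is_RInt_unique. unfold window_sum. rewrite <- zsum_scal.
  apply (is_RInt_ext (fun k => zsum (fun t => f t *
    (cos (k * IZR t) * cosum M g k + sin (k * IZR t) * sisum M g k))
    (- Z.of_nat M) (2 * M + 1))).
  - intros k _. unfold cosum at 2, sisum at 2. unfold window_sum.
    rewrite (Rmult_comm (zsum _ _ _)), (Rmult_comm (zsum _ _ _) (sisum M g k)).
    rewrite <- !zsum_scal, <- zsum_plus. apply zsum_ext. intros t _. ring.
  - apply (is_RInt_zsum (fun t k => f t *
      (cos (k * IZR t) * cosum M g k + sin (k * IZR t) * sisum M g k))).
    intros t Ht. replace (2 * PI * (f t * g t)) with (f t * (2 * PI * g t)) by ring.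
    apply (is_RInt_scal (V := R_NormedModule)), fourier_coef_re. lia.
Qed.

(** At [h = 0] a step of [moment_wave] only multiplies by the velocity and
    exchanges the amplitudes, and two steps multiply by its square. *)
Lemma moment_wave_0 m k :
  let e := fun a => eval c a 0 k in
  let '((p0, q0), (p0', q0')) := moment_wave 0 in
  let '((p, q), (p', q')) := moment_wave m in
  let x := vel c k ^ m in
  if Nat.even m then
    e p = x * e p0 /\ e q = x * e q0 /\ e p' = x * e p0' /\ e q' = x * e q0'
  else
    e p = x * e q0' /\ e q = - (x * e p0') /\ e p' = - (x * e q0) /\ e q' = x * e p0.
Proof.
  intros e. 
  induction m as [|m IH].
  - simpl. repeat split; ring.
  - destruct (moment_wave 0) as [[p0 q0] [p0' q0']].
    cbn [moment_wave]. destruct (moment_wave m) as [[p q] [p' q']].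
    rewrite Nat.even_succ, <- Nat.negb_even.
    unfold e in *. cbn [deriv_wave opp_wave fst snd eval vel_trig] in *.
    change (c * sin k * csc_phase c k) with (vel c k) in *.
    destruct (Nat.even m); simpl negb; cbv iota in *; destruct IH as (-> & -> & -> & ->);
      simpl pow; repeat split; ring.
Qed.

Lemma vel_opp k : vel c (- k) = - vel c k.
Proof. unfold vel, csc_phase. rewrite sin_neg, cos_neg. ring. Qed.

Lemma continuous_vel (k : R) : continuous (vel c) k.
Proof. exact (continuous_eval c s Hcs Hs (vel_trig c) 0 k). Qed.

Lemma continuous_weight v : continuous (weight c s al be) v.
Proof.
  apply (ex_derive_continuous (V := R_NormedModule)).
  unfold weight. auto_derive. exact I.
Qed.

Lemma continuous_weight_vel (g : R -> R) (k : R) : continuous g (vel c k) ->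
  continuous (fun k => g (vel c k) * weight c s al be (vel c k)) k.
Proof.
  intros Hg. apply (continuous_mult (K := R_AbsRing)).
  - apply (continuous_comp (vel c) g); [apply continuous_vel|exact Hg].
  - apply (continuous_comp (vel c) (weight c s al be));
      [apply continuous_vel|apply continuous_weight].
Qed.

(** The factor [/ (4 * PI)] is [/ (2 * PI)] from Parseval's identity times the
    mean value [1 / 2] of [cos^2] and [sin^2]. *)
Definition limit_mean (g : R -> R) : R :=
  / (4 * PI) * RInt (fun k => g (vel c k) * weight c s al be (vel c k)) (- PI) PI.

Definition walk_mean (g : R -> R) (n : nat) : R :=
  window_sum n (fun t => g (IZR t / INR n) * psi n t ^ 2).

(** The limit of the product of waves given by [moment_wave] and the limit with
    [weight] differ by an odd function of [k], because the velocity is odd. *)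
Lemma moment_limit m :
  is_lim_seq (walk_mean (fun x => x ^ m)) (limit_mean (fun x => x ^ m)).
Proof.
  pose proof PI_RGT_0 as HPI.
  destruct (moment_wave m) as [[p q] [p' q']] eqn:Em.
  destruct (moment_wave 0) as [[p0 q0] [p0' q0']] eqn:E0.
  set (L1 := RInt (fun k => / 2 * (eval c p 0 k * eval c p0 0 k + eval c q 0 k * eval c q0 0 k)) (- PI) PI).
  set (L2 := RInt (fun k => / 2 * (eval c p' 0 k * eval c p0' 0 k + eval c q' 0 k * eval c q0' 0 k)) (- PI) PI).
  assert (Hcw : forall w n (k : R), (1 <= n)%nat -> continuous (eval_wave w n) k).
  { intros w n k Hn. apply (ex_derive_continuous (V := R_NormedModule)).
    eexists. now apply is_derive_eval_wave. }
  assert (HL : is_lim_seq (walk_mean (fun x => x ^ m)) (/ (2 * PI) * (L1 + L2))).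
  { apply (is_lim_seq_ext_loc (fun n => / (2 * PI) *
     (RInt (fun k => eval_wave (p, q) n k * eval_wave (p0, q0) n k) (- PI) PI +
      RInt (fun k => eval_wave (p', q') n k * eval_wave (p0', q0') n k) (- PI) PI))).
    - exists 1%nat. intros n Hn.
      rewrite <- RInt_Rplus by
        (apply ex_RInt_cont; intros; apply (continuous_mult (K := R_AbsRing)); now apply Hcw).
      unfold walk_mean.
      transitivity (window_sum n (fun t => ((IZR t / INR n) ^ m * psi n t) * ((IZR t / INR n) ^ 0 * psi n t))).
      2: { apply zsum_ext. intros t _. ring. }
      apply (Rmult_eq_reg_l (2 * PI)); [|lra].
      rewrite <- parseval, <- Rmult_assoc, Rinv_r, Rmult_1_l by lra.
      apply RInt_Rext. intros k _.
      destruct (moment_wave_spec n m Hn k) as [-> ->].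
      destruct (moment_wave_spec n 0 Hn k) as [-> ->].
      now rewrite Em, E0.
    - apply (is_lim_seq_scal_l _ (/ (2 * PI)) (L1 + L2)).
      apply is_lim_seq_plus'; apply (lim_RInt_wave_product c s Hcs Hc Hs). }
  replace (limit_mean (fun x => x ^ m)) with (/ (2 * PI) * (L1 + L2)); [exact HL|].
  unfold limit_mean.
  replace (/ (4 * PI)) with (/ (2 * PI) * / 2) by (field; lra).
  rewrite Rmult_assoc. f_equal.
  assert (Cm : forall k : R, continuous (fun k => vel c k ^ m * weight c s al be (vel c k)) k).
  { intros k. apply (continuous_weight_vel (fun x => x ^ m)).
    apply (ex_derive_continuous (V := R_NormedModule)). auto_derive. exact I. }
  assert (Ce : forall a b a' b' (k : R), continuous (fun k => / 2 *
    (eval c a 0 k * eval c a' 0 k + eval c b 0 k * eval c b' 0 k)) k).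
  { intros a b a' b' k.
    exact (continuous_eval c s Hcs Hs
      (Mul (Cst (/ 2)) (Add (Mul a a') (Mul b b'))) 0 k). }
  rewrite <- RInt_Rscal by (apply ex_RInt_cont; auto).
  unfold L1, L2. rewrite <- RInt_Rplus by (apply ex_RInt_cont; intros; apply Ce).
  apply RInt_even_part.
  - intros k. apply (continuous_plus (V := R_NormedModule)); apply Ce.
  - intros k. apply (continuous_scal_r (V := R_NormedModule)), Cm.
  - intros k.
    pose proof (moment_wave_0 m k) as H1. pose proof (moment_wave_0 m (- k)) as H2.
    cbv zeta in H1, H2. rewrite Em, E0 in H1, H2. cbv beta iota in H1, H2.
    simpl in E0. injection E0 as <- <- <- <-.
    cbn [eval vel_trig] in H1, H2 |- *.
    change (c * sin k * csc_phase c k) with (vel c k) in *.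
    change (c * sin (- k) * csc_phase c (- k)) with (vel c (- k)) in *.
    rewrite vel_opp in *. rewrite sin_neg, cos_neg in *.
    assert (Ei : csc_phase c (- k) = csc_phase c k) by (unfold csc_phase; now rewrite cos_neg).
    rewrite Ei in *.
    destruct (vel_identities c s Hcs Hs k) as [Es _].
    assert (Ev : s / c * vel c k = s * csc_phase c k * sin k) by (unfold vel; field; exact Hc).
    assert (Es' : be ^ 2 * ((s * csc_phase c k) ^ 2 * cos k ^ 2 + (s * csc_phase c k) ^ 2 * sin k ^ 2)
              = be ^ 2 * (1 - vel c k ^ 2)).
    { rewrite <- Es, <- Rmult_plus_distr_l. f_equal.
      pose proof (sin2_cos2 k) as Hk. unfold Rsqr in Hk.
      replace (cos k ^ 2 + sin k ^ 2) with 1 by lra. ring. }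
    unfold weight.
    set (v := vel c k) in *. set (sg := s * csc_phase c k) in *.
    replace (2 * al * be * (s / c) * (v * (1 + v)))
      with (2 * al * be * (1 + v) * (s / c * v)) by ring.
    replace (2 * al * be * (s / c) * (- v * (1 + - v)))
      with (2 * al * be * - (1 - v) * (s / c * v)) by ring.
    rewrite Ev.
    (* The even part of [weight] pairs with even powers of the velocity and its
       odd part with odd powers. *)
    destruct (Nat.even m) eqn:Epar.
    + assert (Hp : (- v) ^ m = v ^ m).
      { apply Nat.even_spec in Epar. destruct Epar as [j ->].
        rewrite !pow_mult. f_equal. ring. }
      rewrite Hp in *.
      destruct H1 as (-> & -> & -> & ->). destruct H2 as (-> & -> & -> & ->).
      replace ((- v) ^ 2) with (v ^ 2) by ring.
      rewrite <- Es'. unfold sg.  ring.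
    + assert (Hp : (- v) ^ m = - v ^ m).
      { assert (Hodd : Nat.odd m = true) by (rewrite <- Nat.negb_even, Epar; reflexivity).
        apply Nat.odd_spec in Hodd. destruct Hodd as [j ->].
        rewrite !pow_add, !pow_mult. replace ((- v) ^ 2) with (v ^ 2) by ring. ring. }
      rewrite Hp in *.
      destruct H1 as (-> & -> & -> & ->). destruct H2 as (-> & -> & -> & ->).
      replace ((- v) ^ 2) with (v ^ 2) by ring.
      unfold sg. ring.
Qed.

End Moments.

(** * From moments to intervals *)

Lemma polynomial_continuous f : polynomial f -> forall x : R, continuous f x.
Proof.
  induction 1 as [a|f _ IH|f g _ IHf _ IHg|f g E _ IH]; intros x.
  - apply (continuous_const (V := R_UniformSpace)).
  - apply (continuous_mult (K := R_AbsRing)); [apply continuous_id|apply IH].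
  - apply (continuous_plus (V := R_NormedModule)); [apply IHf|apply IHg].
  - apply (continuous_ext f); [exact E|apply IH].
Qed.

Lemma lipschitz_continuous L g : 0 <= L -> lipschitz L g ->
  forall x : R, continuous g x.
Proof.
  intros HL H x. apply filterlim_locally. intros e.
  assert (He : 0 < e / (L + 1)) by (apply Rdiv_lt_0_compat; [apply cond_pos|lra]).
  exists (mkposreal _ He). intros y Hy.
  change (Rabs (y - x) < e / (L + 1)) in Hy.
  change (Rabs (g y - g x) < e).
  eapply Rle_lt_trans; [apply H|].
  assert (E : e / (L + 1) * (L + 1) = e) by (field; lra).
  pose proof (Rabs_pos (y - x)). nra.
Qed.

(** For [a < b] it lies between the indicators of [x <= a] and of [x <= b]. *)
Definition ramp (a b x : R) : R := Rmin 1 (Rmax 0 ((b - x) / (b - a))).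

Lemma clamp_contraction u w :
  Rabs (Rmin 1 (Rmax 0 u) - Rmin 1 (Rmax 0 w)) <= Rabs (u - w).
Proof.
  unfold Rmin, Rmax.
  destruct (Rle_dec 0 u), (Rle_dec 0 w); repeat destruct Rle_dec;
    unfold Rabs; repeat destruct Rcase_abs; lra.
Qed.

Lemma ramp_lipschitz a b : a < b -> lipschitz (/ (b - a)) (ramp a b).
Proof.
  intros Hab x y. unfold ramp. eapply Rle_trans; [apply clamp_contraction|].
  replace ((b - x) / (b - a) - (b - y) / (b - a)) with (/ (b - a) * (y - x))
    by (field; lra).
  assert (0 < / (b - a)) by (apply Rinv_0_lt_compat; lra).
  rewrite Rabs_mult, (Rabs_pos_eq (/ (b - a))), (Rabs_minus_sym x) by lra. lra.
Qed.

Lemma ramp_range a b x : 0 <= ramp a b x <= 1.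
Proof.
  unfold ramp, Rmin, Rmax. repeat destruct Rle_dec; lra.
Qed.

Lemma ramp_left a b x : a < b -> x <= a -> ramp a b x = 1.
Proof.
  intros Hab Hx. unfold ramp.
  assert (1 <= (b - x) / (b - a)).
  { apply (Rmult_le_reg_r (b - a)); [lra|].
    replace ((b - x) / (b - a) * (b - a)) with (b - x) by (field; lra). lra. }
  rewrite Rmax_right by lra. now apply Rmin_left.
Qed.

Lemma ramp_right a b x : a < b -> b <= x -> ramp a b x = 0.
Proof.
  intros Hab Hx. unfold ramp.
  assert ((b - x) / (b - a) <= 0).
  { apply (Rmult_le_reg_r (b - a)); [lra|].
    replace ((b - x) / (b - a) * (b - a)) with (b - x) by (field; lra). lra. }
  rewrite Rmax_left by lra. apply Rmin_right. lra.
Qed.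

Section Distribution.
Variables c s : R.
Hypothesis Hcs : c ^ 2 + s ^ 2 = 1.
Hypothesis Hc : 0 < c.
Hypothesis Hs : s <> 0.
Variables al be : R.

Let Hc0 : c <> 0 := Rgt_not_eq _ _ Hc.

Notation wt := (weight c s al be).
Notation mean := (walk_mean c s al be).
Notation lmean := (limit_mean c s al be).

Lemma mean_plus f g n : mean (fun x => f x + g x) n = mean f n + mean g n.
Proof.
  unfold walk_mean, window_sum. rewrite <- zsum_plus. apply zsum_ext. intros t _. ring.
Qed.

Lemma mean_scal a f n : mean (fun x => a * f x) n = a * mean f n.
Proof.
  unfold walk_mean, window_sum. rewrite <- zsum_scal. apply zsum_ext. intros t _. ring.
Qed.

Lemma window_range n t : (1 <= n)%nat ->
  (- Z.of_nat n <= t < - Z.of_nat n + Z.of_nat (2 * n + 1))%Z ->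
  -1 <= IZR t / INR n <= 1.
Proof.
  intros Hn Ht. assert (Hn1 : 0 < INR n) by (apply lt_0_INR; lia).
  assert (H1 : IZR (- Z.of_nat n) <= IZR t) by (apply IZR_le; lia).
  assert (H2 : IZR t <= IZR (Z.of_nat n)) by (apply IZR_le; lia).
  rewrite opp_IZR in H1. rewrite <- INR_IZR_INZ in H1, H2.
  split; apply (Rmult_le_reg_r (INR n)); auto;
    unfold Rdiv; rewrite Rmult_assoc, Rinv_l by lra; lra.
Qed.

(** Only the values on [-1, 1] matter, since a walk of [n] steps stays within
    distance [n]. *)
Lemma mean_le f g n : (1 <= n)%nat ->
  (forall x, -1 <= x <= 1 -> f x <= g x) -> mean f n <= mean g n.
Proof.
  intros Hn H. apply zsum_le. intros t Ht.
  apply Rmult_le_compat_r; [apply pow2_ge_0|]. apply H.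
  now apply window_range.
Qed.

Lemma limit_mean_ext f g : (forall x, f x = g x) -> lmean f = lmean g.
Proof.
  intros H. unfold limit_mean. f_equal. apply RInt_Rext. intros k _. now rewrite H.
Qed.

Lemma mean_ext f g n : (forall x, f x = g x) -> mean f n = mean g n.
Proof. intros H. apply zsum_ext. intros t _. now rewrite H. Qed.

Lemma ex_RInt_weighted g a b : (forall x : R, continuous g x) ->
  ex_RInt (fun k => g (vel c k) * wt (vel c k)) a b.
Proof. intros Hg. apply ex_RInt_cont. intros k. apply continuous_weight_vel; auto. Qed.

Lemma limit_mean_plus f g :
  (forall x : R, continuous f x) -> (forall x : R, continuous g x) ->
  lmean (fun x => f x + g x) = lmean f + lmean g.
Proof.
  intros Hf Hg. unfold limit_mean. rewrite <- Rmult_plus_distr_l. f_equal.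
  rewrite <- RInt_Rplus by now apply ex_RInt_weighted.
  apply RInt_Rext. intros k _. ring.
Qed.

Lemma limit_mean_scal a f : (forall x : R, continuous f x) ->
  lmean (fun x => a * f x) = a * lmean f.
Proof.
  intros Hf. unfold limit_mean.
  rewrite <- (Rmult_assoc a), (Rmult_comm a), Rmult_assoc. f_equal.
  rewrite <- RInt_Rscal by now apply ex_RInt_weighted.
  apply RInt_Rext. intros k _. ring.
Qed.

(** Proved with an additional factor [x ^ m], which absorbs the multiplications
    by [x] in the induction. *)
Lemma polynomial_limit q : polynomial q -> is_lim_seq (mean q) (lmean q).
Proof.
  intros Hq.
  assert (H : forall m, is_lim_seq (mean (fun x => x ^ m * q x))
                                   (lmean (fun x => x ^ m * q x))).
  { assert (Hpow : forall m (x : R), continuous (fun x => x ^ m) x).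
    { intros m x. apply (ex_derive_continuous (V := R_NormedModule)).
      auto_derive. exact I. }
    induction Hq as [a|f Hf IH|f g Hf IHf Hg IHg|f g E Hf IH]; intros m.
    - apply (is_lim_seq_ext (fun n => a * mean (fun x => x ^ m) n)).
      { intros n. rewrite <- mean_scal. apply mean_ext. intros; ring. }
      rewrite (limit_mean_ext _ (fun x => a * x ^ m)) by (intros; ring).
      rewrite limit_mean_scal by apply Hpow.
      apply (is_lim_seq_scal_l _ a (lmean (fun x => x ^ m))).
      now apply moment_limit.
    - apply (is_lim_seq_ext (mean (fun x => x ^ S m * f x))).
      { intros n. apply mean_ext. intros; simpl; ring. }
      rewrite (limit_mean_ext _ (fun x => x ^ S m * f x)) by (intros; simpl; ring).
      apply IH.
    - apply (is_lim_seq_ext (fun n => mean (fun x => x ^ m * f x) n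
                                      + mean (fun x => x ^ m * g x) n)).
      { intros n. rewrite <- mean_plus. apply mean_ext. intros; ring. }
      rewrite (limit_mean_ext _ (fun x => x ^ m * f x + x ^ m * g x)) by (intros; ring).
      rewrite limit_mean_plus; [now apply is_lim_seq_plus'| |];
        intros x; apply (continuous_mult (K := R_AbsRing)); try apply Hpow;
        now apply polynomial_continuous.
    - apply (is_lim_seq_ext (mean (fun x => x ^ m * f x))).
      { intros n. apply mean_ext. intros x. now rewrite E. }
      rewrite (limit_mean_ext _ (fun x => x ^ m * f x)) by (intros x; now rewrite E).
      apply IH. }
  apply (is_lim_seq_ext (mean (fun x => x ^ 0 * q x))).
  { intros n. apply mean_ext. intros; ring. }
  rewrite (limit_mean_ext _ (fun x => x ^ 0 * q x)) by (intros; ring).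
  apply H.
Qed.

Lemma weight_bounded : exists K, 0 <= K /\ forall k, Rabs (wt (vel c k)) <= K.
Proof.
  set (D := Rabs (2 * al * be * (s / c))).
  exists (4 * al ^ 2 + be ^ 2 + 2 * D). split.
  { pose proof (pow2_ge_0 al). pose proof (pow2_ge_0 be).
    pose proof (Rabs_pos (2 * al * be * (s / c))). unfold D. lra. }
  intros k. destruct (vel_identities c s Hcs Hs k) as (_ & Hv & _).
  set (v := vel c k) in *. unfold weight.
  eapply Rle_trans; [apply Rabs_triang|]. apply Rplus_le_compat.
  - eapply Rle_trans; [apply Rabs_triang|].
    pose proof (pow2_ge_0 al). pose proof (pow2_ge_0 be).
    rewrite !Rabs_pos_eq by (apply Rmult_le_pos; nra).
    assert ((1 + v) ^ 2 <= 4) by nra. assert (1 - v ^ 2 <= 1) by nra.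
    nra.
  - rewrite Rabs_mult. fold D. rewrite (Rmult_comm 2).
    apply Rmult_le_compat_l; [apply Rabs_pos|].
    apply Rabs_le. nra.
Qed.

(** The total mass converges, hence stays bounded, so uniform approximation of
    [g] by polynomials on [-1, 1] carries over to the means. *)
Lemma lipschitz_limit g L : 0 <= L -> lipschitz L g -> is_lim_seq (mean g) (lmean g).
Proof.
  intros HL Hg. pose proof PI_RGT_0 as HPI.
  pose proof (lipschitz_continuous L g HL Hg) as Cg.
  destruct weight_bounded as [K [HK HW]].
  destruct (proj1 (lim_seq_eps _ _) (polynomial_limit _ (polynomial_const 1)) 1 Rlt_0_1)
    as [N0 HN0].
  (* [T] bounds the total mass at late times, [K] the weight. *)
  set (T := lmean (fun _ => 1) + 1).
  assert (HT : forall n, (N0 <= n)%nat -> mean (fun _ => 1) n <= T).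
  { intros n Hn. specialize (HN0 n Hn). apply Rabs_def2 in HN0. unfold T. lra. }
  assert (HT0 : 0 <= T).
  { apply (Rle_trans _ (mean (fun _ => 1) N0)); [|now apply HT].
    unfold walk_mean. rewrite <- (zsum_zero (fun _ => 0) (2 * N0 + 1) (- Z.of_nat N0)) by reflexivity.
    apply zsum_le. intros t _. pose proof (pow2_ge_0 (psi c s al be N0 t)). lra. }
  apply lim_seq_eps. intros e He.
  set (d := e / (2 * (T + K + 1))).
  assert (Hd : 0 < d) by (apply Rdiv_lt_0_compat; lra).
  destruct (lipschitz_approx g L HL Hg d Hd) as [q [Hq Hqg]].
  pose proof (polynomial_continuous q Hq) as Cq.
  destruct (proj1 (lim_seq_eps _ _) (polynomial_limit q Hq) (e / 2) ltac:(lra)) as [N1 HN1].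
  exists (S (N0 + N1)). intros n Hn.
  specialize (HN1 n ltac:(lia)). specialize (HT n ltac:(lia)).
  assert (H1 : mean g n <= mean q n + d * T).
  { apply (Rle_trans _ (mean (fun x => q x + d * 1) n)).
    - apply mean_le; [lia|]. intros x Hx. specialize (Hqg x Hx).
      apply Rabs_le_between in Hqg. lra.
    - rewrite (mean_plus q), (mean_scal d (fun _ => 1)). nra. }
  assert (H2 : mean q n <= mean g n + d * T).
  { apply (Rle_trans _ (mean (fun x => g x + d * 1) n)).
    - apply mean_le; [lia|]. intros x Hx. specialize (Hqg x Hx).
      apply Rabs_le_between in Hqg. lra.
    - rewrite (mean_plus g), (mean_scal d (fun _ => 1)). nra. }
  assert (H3 : Rabs (lmean q - lmean g) <= d * K).
  { unfold limit_mean. rewrite <- Rmult_minus_distr_l.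
    rewrite <- RInt_Rminus by now apply ex_RInt_weighted.
    rewrite Rabs_mult, Rabs_pos_eq by (apply Rlt_le, Rinv_0_lt_compat; lra).
    apply (Rle_trans _ (/ (4 * PI) * ((PI - - PI) * (d * K)))).
    - apply Rmult_le_compat_l; [apply Rlt_le, Rinv_0_lt_compat; lra|].
      apply RInt_abs_le_const; [lra| |].
      + apply (ex_RInt_minus (V := R_NormedModule)); now apply ex_RInt_weighted.
      + intros k _. rewrite <- Rmult_minus_distr_r, Rabs_mult.
        apply Rmult_le_compat; auto using Rabs_pos.
        apply Hqg. destruct (vel_identities c s Hcs Hs k) as (_ & Hv & _). lra.
    - replace (/ (4 * PI) * ((PI - - PI) * (d * K))) with (d * K / 2) by (field; lra).
      assert (0 <= d * K) by nra. lra. }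
  assert (E : d * (T + K + 1) = e / 2) by (unfold d; field; lra).
  apply Rabs_def2 in HN1. apply Rabs_le_between in H3.
  apply Rabs_def1; nra.
Qed.

(** The velocity is even about [PI / 2] and about [- PI / 2], so the momenta in
    [- PI / 2, PI / 2] carry half of every mean. *)
Lemma limit_mean_half g : (forall x : R, continuous g x) ->
  lmean g = / (2 * PI) *
    RInt (fun k => g (vel c k) * wt (vel c k)) (- (PI / 2)) (PI / 2).
Proof.
  intros Hg. pose proof PI_RGT_0 as HPI. unfold limit_mean.
  set (G := fun k => g (vel c k) * wt (vel c k)).
  assert (CG : forall k : R, continuous G k) by (intros; apply continuous_weight_vel; auto).
  assert (Hmir : forall j k, (j = 1 \/ j = -1) -> G (j * PI - k) = G k).
  { intros j k Hj. unfold G. replace (vel c (j * PI - k)) with (vel c k); [reflexivity|].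
    unfold vel, csc_phase. rewrite sin_minus, cos_minus.
    assert (Hcj : cos (j * PI) = -1 /\ sin (j * PI) = 0).
    { destruct Hj as [->| ->].
      - rewrite Rmult_1_l. split; [apply cos_PI|apply sin_PI].
      - replace (-1 * PI) with (- PI) by ring. rewrite cos_neg, sin_neg, cos_PI, sin_PI.
        split; lra. }
    destruct Hcj as [-> ->].
    replace ((c * (-1 * cos k + 0 * sin k)) ^ 2) with ((c * cos k) ^ 2) by ring. ring. }
  rewrite (RInt_split G (- PI) (- (PI / 2)) PI), (RInt_split G (- (PI / 2)) (PI / 2) PI) by auto.
  assert (E1 : RInt G (PI / 2) PI = RInt G 0 (PI / 2)).
  { rewrite <- (RInt_Rext (fun k => G (1 * PI - k)) G) by (intros; apply Hmir; auto).
    rewrite RInt_mirror by auto. f_equal; field. }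
  assert (E2 : RInt G (- PI) (- (PI / 2)) = RInt G (- (PI / 2)) 0).
  { rewrite <- (RInt_Rext (fun k => G (-1 * PI - k)) G) by (intros; apply Hmir; auto).
    rewrite RInt_mirror by auto. f_equal; field. }
  rewrite E1, E2, (RInt_split G (- (PI / 2)) 0 (PI / 2)) by auto. field. lra.
Qed.

Definition dvel (k : R) : R := c * s ^ 2 * cos k * csc_phase c k ^ 3.

Lemma is_derive_vel (k : R) : is_derive (vel c) k (dvel k).
Proof.
  replace (dvel k) with (eval c (diff c (vel_trig c)) 0 k).
  - exact (is_derive_eval c s Hcs Hs (vel_trig c) 0 k).
  - simpl. unfold dvel. destruct (vel_identities c s Hcs Hs k) as [E _].
    unfold vel in E.
    replace (c * s ^ 2 * cos k * csc_phase c k ^ 3) with (c * cos k * csc_phase c k * (s * csc_phase c k) ^ 2) by ring.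
    rewrite E. ring.
Qed.

Lemma vel_increasing k1 k2 :
  - (PI / 2) < k1 -> k1 < k2 -> k2 < PI / 2 -> vel c k1 < vel c k2.
Proof.
  intros H1 H2 H3.
  apply (incr_function (vel c) (- (PI / 2)) (PI / 2) dvel); simpl; auto.
  - intros k _ _. apply is_derive_vel.
  - intros k Hk1 Hk2. unfold dvel. pose proof (csc_phase_pos c s Hcs Hs k).
    assert (0 < cos k) by (apply cos_gt_0; lra).
    assert (0 < s ^ 2) by (apply pow2_gt_0, Hs).
    apply Rmult_lt_0_compat; [|apply pow_lt; lra].
    apply Rmult_lt_0_compat; [|lra]. apply Rmult_lt_0_compat; lra.
Qed.

Lemma vel_surjective y : - c < y < c ->
  exists k, - (PI / 2) < k < PI / 2 /\ vel c k = y.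
Proof.
  intros Hy. pose proof PI_RGT_0 as HPI.
  assert (E1 : vel c (PI / 2) = c).
  { unfold vel, csc_phase. rewrite sin_PI2, cos_PI2.
    replace (1 - (c * 0) ^ 2) with 1 by ring. rewrite sqrt_1. field. }
  assert (E2 : vel c (- (PI / 2)) = - c) by (rewrite vel_opp, E1; reflexivity).
  destruct (IVT_gen (vel c) (- (PI / 2)) (PI / 2) y) as [k [Hk Ek]].
  - intros x. apply continuity_pt_filterlim.
    apply (continuous_vel c s Hcs Hs).
  - rewrite E1, E2, Rmin_left, Rmax_right by lra. lra.
  - rewrite Rmin_left, Rmax_right in Hk by lra. exists k. split; [|exact Ek].
    assert (k <> PI / 2) by (intros ->; lra).
    assert (k <> - (PI / 2)) by (intros ->; lra). lra.
Qed.

(** The limiting mass of the velocities below [vel k]; it is kept as an integral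
    over momenta until the final change of variables. *)
Definition cdf (k : R) : R :=
  / (2 * PI) * RInt (fun k => wt (vel c k)) (- (PI / 2)) k.

Lemma continuous_wt_vel (k : R) : continuous (fun k => wt (vel c k)) k.
Proof.
  apply (continuous_ext (fun k => 1 * wt (vel c k))); [intros; apply Rmult_1_l|].
  apply (continuous_weight_vel c s Hcs Hs al be (fun _ => 1)).
  apply (continuous_const (V := R_UniformSpace)).
Qed.

(** The ramp differs from the indicators of [v <= vel k1] and [v <= vel k2] only
    for momenta between [k1] and [k2] (and their mirror images), so the error is
    controlled by [k2 - k1]; the density may be unbounded. *)
Lemma ramp_mean K k1 k2 : (forall k, Rabs (wt (vel c k)) <= K) ->
  - (PI / 2) < k1 -> k1 < k2 -> k2 < PI / 2 ->
  Rabs (lmean (ramp (vel c k1) (vel c k2)) - cdf k1) <= (k2 - k1) * K /\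
  Rabs (lmean (ramp (vel c k1) (vel c k2)) - cdf k2) <= (k2 - k1) * K.
Proof.
  intros HK H1 H2 H3. pose proof PI2_3_2 as HPI.
  assert (HK0 : 0 <= K) by (eapply Rle_trans; [apply Rabs_pos|apply (HK 0)]).
  pose proof (vel_increasing k1 k2 H1 H2 H3) as Hv.
  set (g := ramp (vel c k1) (vel c k2)).
  assert (Cg : forall x : R, continuous g x).
  { intros x. apply (lipschitz_continuous (/ (vel c k2 - vel c k1))).
    - apply Rlt_le, Rinv_0_lt_compat. lra.
    - now apply ramp_lipschitz. }
  rewrite limit_mean_half by exact Cg. unfold cdf.
  assert (CG : forall k : R, continuous (fun k => g (vel c k) * wt (vel c k)) k)
    by (intros; apply continuous_weight_vel; auto).
  rewrite (RInt_split _ (- (PI / 2)) k1 (PI / 2)), (RInt_split _ k1 k2 (PI / 2)) by auto.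
  rewrite (RInt_split (fun k => wt (vel c k)) (- (PI / 2)) k1 k2) by apply continuous_wt_vel.
  rewrite (RInt_Rext (fun k => g (vel c k) * wt (vel c k)) (fun k => wt (vel c k)) (- (PI / 2)) k1).
  2: { rewrite Rmin_left, Rmax_right by lra. intros k Hk. unfold g.
       rewrite ramp_left; [ring|exact Hv|]. apply Rlt_le, vel_increasing; lra. }
  rewrite (RInt_Rext (fun k => g (vel c k) * wt (vel c k)) (fun k => 0) k2 (PI / 2)).
  2: { rewrite Rmin_left, Rmax_right by lra. intros k Hk. unfold g.
       rewrite ramp_right; [ring|exact Hv|]. apply Rlt_le, vel_increasing; lra. }
  rewrite RInt_const. unfold scal; simpl; unfold mult; simpl.
  rewrite Rmult_0_r.
  set (A := RInt (fun k => wt (vel c k)) (- (PI / 2)) k1).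
  set (Bg := RInt (fun k => g (vel c k) * wt (vel c k)) k1 k2).
  set (B := RInt (fun k => wt (vel c k)) k1 k2).
  assert (Hi : 0 < / (2 * PI)) by (apply Rinv_0_lt_compat; lra).
  assert (Hi1 : / (2 * PI) <= 1) by (rewrite <- Rinv_1; apply Rinv_le_contravar; lra).
  assert (HBg : Rabs Bg <= (k2 - k1) * K).
  { apply RInt_abs_le_const; [lra|apply ex_RInt_cont; auto|].
    intros k _. rewrite Rabs_mult. pose proof (ramp_range (vel c k1) (vel c k2) (vel c k)) as Hr.
    fold g in Hr. rewrite Rabs_pos_eq by lra.
    specialize (HK k). pose proof (Rabs_pos (wt (vel c k))). nra. }
  assert (HBd : Rabs (Bg - B) <= (k2 - k1) * K).
  { unfold Bg, B. rewrite <- RInt_Rminus by (apply ex_RInt_cont; auto using continuous_wt_vel).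
    apply RInt_abs_le_const; [lra| |].
    - apply (ex_RInt_minus (V := R_NormedModule)); apply ex_RInt_cont; auto using continuous_wt_vel.
    - intros k _. pose proof (ramp_range (vel c k1) (vel c k2) (vel c k)) as Hr.
      fold g in Hr.
      replace (g (vel c k) * wt (vel c k) - wt (vel c k)) with (- (1 - g (vel c k)) * wt (vel c k)) by ring.
      rewrite Rabs_mult, Rabs_Ropp, Rabs_pos_eq by lra.
      specialize (HK k). pose proof (Rabs_pos (wt (vel c k))). nra. }
  split.
  - replace (/ (2 * PI) * (A + (Bg + 0)) - / (2 * PI) * A) with (/ (2 * PI) * Bg) by ring.
    rewrite Rabs_mult, (Rabs_pos_eq (/ (2 * PI))) by lra. pose proof (Rabs_pos Bg). nra.
  - replace (/ (2 * PI) * (A + (Bg + 0)) - / (2 * PI) * (A + B)) with (/ (2 * PI) * (Bg - B)) by ring.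
    rewrite Rabs_mult, (Rabs_pos_eq (/ (2 * PI))) by lra. pose proof (Rabs_pos (Bg - B)). nra.
Qed.

Definition below (y x : R) : R := if Rle_dec x y then 1 else 0.

(** Ramps just above and just below [vel k] squeeze the indicator, and both have
    a limiting mean close to [cdf k]. *)
Lemma below_limit k : - (PI / 2) < k < PI / 2 ->
  is_lim_seq (mean (below (vel c k))) (cdf k).
Proof.
  intros Hk. destruct weight_bounded as [K [HK0 HK]].
  apply lim_seq_eps. intros e He.
  (* [k - d] and [k + d] stay in the range where the velocity increases, and the
     error [d K] of [ramp_mean] is at most [e / 2]. *)
  set (d := Rmin (Rmin ((PI / 2 - k) / 2) ((k + PI / 2) / 2)) (e / (2 * (K + 1)))).
  assert (Hd : 0 < d).
  { apply Rmin_glb_lt; [apply Rmin_glb_lt; lra|]. apply Rdiv_lt_0_compat; lra. }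
  assert (Hd1 : d <= (PI / 2 - k) / 2) by (eapply Rle_trans; apply Rmin_l).
  assert (Hd2 : d <= (k + PI / 2) / 2) by (eapply Rle_trans; [apply Rmin_l|apply Rmin_r]).
  assert (Hd3 : d <= e / (2 * (K + 1))) by apply Rmin_r.
  assert (HdK : d * K <= e / 2).
  { apply (Rle_trans _ (e / (2 * (K + 1)) * (K + 1))); [nra|]. right. field. lra. }
  assert (Hlip : forall k1 k2, - (PI / 2) < k1 -> k1 < k2 -> k2 < PI / 2 ->
    is_lim_seq (mean (ramp (vel c k1) (vel c k2))) (lmean (ramp (vel c k1) (vel c k2)))).
  { intros k1 k2 H1 H2 H3. pose proof (vel_increasing k1 k2 H1 H2 H3).
    apply (lipschitz_limit _ (/ (vel c k2 - vel c k1))).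
    - apply Rlt_le, Rinv_0_lt_compat. lra.
    - now apply ramp_lipschitz. }
  destruct (ramp_mean K k (k + d) HK ltac:(lra) ltac:(lra) ltac:(lra)) as [Hup _].
  destruct (ramp_mean K (k - d) k HK ltac:(lra) ltac:(lra) ltac:(lra)) as [_ Hlo].
  destruct (proj1 (lim_seq_eps _ _) (Hlip k (k + d) ltac:(lra) ltac:(lra) ltac:(lra))
    (e / 2) ltac:(lra)) as [N1 HN1].
  destruct (proj1 (lim_seq_eps _ _) (Hlip (k - d) k ltac:(lra) ltac:(lra) ltac:(lra))
    (e / 2) ltac:(lra)) as [N2 HN2].
  pose proof (vel_increasing k (k + d) ltac:(lra) ltac:(lra) ltac:(lra)) as V1.
  pose proof (vel_increasing (k - d) k ltac:(lra) ltac:(lra) ltac:(lra)) as V2.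
  exists (S (N1 + N2)). intros n Hn.
  specialize (HN1 n ltac:(lia)). specialize (HN2 n ltac:(lia)).
  assert (H1 : mean (below (vel c k)) n <= mean (ramp (vel c k) (vel c (k + d))) n).
  { apply mean_le; [lia|]. intros x _. unfold below. destruct (Rle_dec x (vel c k)).
    - rewrite ramp_left; lra.
    - apply ramp_range. }
  assert (H2 : mean (ramp (vel c (k - d)) (vel c k)) n <= mean (below (vel c k)) n).
  { apply mean_le; [lia|]. intros x _. unfold below. destruct (Rle_dec x (vel c k)).
    - apply ramp_range.
    - rewrite ramp_right; lra. }
  apply Rabs_def2 in HN1. apply Rabs_def2 in HN2.
  apply Rabs_le_between in Hup. apply Rabs_le_between in Hlo.
  replace (k + d - k) with d in Hup by ring. replace (k - (k - d)) with d in Hlo by ring.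
  apply Rabs_def1; lra.
Qed.

End Distribution.

Section Konno.
Variable theta : R.
Hypothesis Hc : 0 < cos theta.
Hypothesis Hs : sin theta <> 0.
Variables al be : R.

Let Hcs : cos theta ^ 2 + sin theta ^ 2 = 1.
Proof. pose proof (sin2_cos2 theta) as H. unfold Rsqr in H. lra. Qed.

Notation c := (cos theta).
Notation s := (sin theta).

Lemma continuous_fK (y : R) : - c < y < c -> continuous (fun y => fK y theta) y.
Proof.
  intros Hy. pose proof (COS_bound theta) as Hb.
  assert (Hc2 : 0 < c ^ 2 - y ^ 2) by nra.
  assert (Hy2 : 0 < 1 - y ^ 2) by nra.
  apply (continuous_ext_loc _ (fun y => 1 / PI * (Rabs s / ((1 - y ^ 2) * sqrt (c ^ 2 - y ^ 2))) * 1)).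
  - assert (Hd : 0 < Rmin (c - y) (y + c)) by (apply Rmin_glb_lt; lra).
    exists (mkposreal _ Hd). intros z Hz. change (Rabs (z - y) < Rmin (c - y) (y + c)) in Hz.
    unfold fK. destruct Rle_dec as [_|n]; [reflexivity|exfalso; apply n].
    pose proof (Rmin_l (c - y) (y + c)). pose proof (Rmin_r (c - y) (y + c)).
    apply Rabs_def2 in Hz. apply Rabs_le. lra.
  - apply (ex_derive_continuous (V := R_NormedModule)).
    assert (0 < sqrt (c ^ 2 - y ^ 2)) by (now apply sqrt_lt_R0).
    auto_derive. simpl in *. repeat split; try lra.
    apply Rmult_integral_contrapositive. split; [|apply Rgt_not_eq]; try lra.
    replace (c * (c * 1) + - (y * (y * 1))) with (c * (c * 1) - y * (y * 1)) by ring. lra.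
Qed.

(** In other words [fK] is the density of the push-forward of [dk / PI] under the
    velocity.  By [vel_identities], [1 - vel^2] and [c^2 - vel^2] are squares. *)
Lemma dvel_fK k : - (PI / 2) < k < PI / 2 ->
  dvel c s k * fK (vel c k) theta = / PI.
Proof.
  intros Hk. pose proof PI_RGT_0 as HPI.
  assert (Hck : 0 < cos k) by (apply cos_gt_0; lra).
  pose proof (csc_phase_pos c s Hcs Hs k) as Hi.
  destruct (vel_identities c s Hcs Hs k) as (E1 & Hv & E2).
  assert (Has : 0 < Rabs s) by now apply Rabs_pos_lt.
  unfold fK. destruct Rle_dec as [_|n].
  2: { exfalso; apply n. apply Rabs_le. pose proof (pow2_ge_0 (c * s * csc_phase c k * cos k)). nra. }
  rewrite <- E1, E2.
  replace ((c * s * csc_phase c k * cos k) ^ 2) with ((c * Rabs s * csc_phase c k * cos k) ^ 2).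
  2: { rewrite !Rpow_mult_distr, <- (pow2_abs s). reflexivity. }
  rewrite sqrt_pow2 by (repeat apply Rmult_le_pos; lra).
  unfold dvel.
  rewrite Rpow_mult_distr, <- (pow2_abs s). field. lra.
Qed.

(** The two end points are velocities [vel k1] and [vel k2]; substitute
    [a = vel k] in the integral of the weight over [k1, k2]. *)
Lemma walk_interval_limit y1 y2 : - c < y1 -> y1 < y2 -> y2 < c ->
  is_lim_seq (fun n => walk_mean c s al be (below y2) n - walk_mean c s al be (below y1) n)
    (/ 2 * RInt (fun a => weight c s al be a * fK a theta) y1 y2).
Proof.
  intros H1 H2 H3. pose proof PI_RGT_0 as HPI.
  destruct (vel_surjective c s Hcs Hc Hs y1) as [k1 [Hk1 E1]]; [lra|].
  destruct (vel_surjective c s Hcs Hc Hs y2) as [k2 [Hk2 E2]]; [lra|].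
  assert (Hk : k1 < k2).
  { destruct (Rlt_le_dec k1 k2) as [|[Hlt| Heq]]; [assumption| |].
    - pose proof (vel_increasing c s Hcs Hc Hs k2 k1 ltac:(lra) ltac:(lra) ltac:(lra)). lra.
    - subst k2. lra. }
  replace (/ 2 * RInt (fun a => weight c s al be a * fK a theta) y1 y2)
    with (cdf c s al be k2 - cdf c s al be k1).
  - subst y1 y2. apply is_lim_seq_minus'; now apply below_limit.
  - unfold cdf.
    rewrite (RInt_split _ (- (PI / 2)) k1 k2) by (intros; now apply continuous_wt_vel).
    rewrite <- E1, <- E2.
    rewrite <- (RInt_comp (V := R_CompleteNormedModule)
      (fun a => weight c s al be a * fK a theta) (vel c) (dvel c s)).
    + rewrite (RInt_Rext (fun k => scal (dvel c s k) _)
        (fun k => / PI * weight c s al be (vel c k))).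
      * rewrite RInt_Rscal by (apply ex_RInt_cont; intros; now apply continuous_wt_vel).
        field. lra.
      * rewrite Rmin_left, Rmax_right by lra. intros k Hkk.
        unfold scal; simpl; unfold mult; simpl.
        rewrite <- (dvel_fK k) by lra. ring.
    + rewrite Rmin_left, Rmax_right by lra. intros k Hkk.
      apply (continuous_mult (K := R_AbsRing)); [apply continuous_weight|].
      apply continuous_fK.
      destruct Hkk as [[Ha|Ha] [Hb|Hb]]; subst; try lra.
      * pose proof (vel_increasing c s Hcs Hc Hs k1 k ltac:(lra) ltac:(lra) ltac:(lra)).
        pose proof (vel_increasing c s Hcs Hc Hs k k2 ltac:(lra) ltac:(lra) ltac:(lra)). lra.
    + intros k _. split; [now apply is_derive_vel|].
      apply (continuous_ext (eval c (diff c (vel_trig c)) 0)).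
      * intros x. rewrite <- (is_derive_unique _ _ _ (is_derive_vel c s Hcs Hs x)).
        symmetry. apply is_derive_unique. exact (is_derive_eval c s Hcs Hs (vel_trig c) 0 x).
      * apply (continuous_eval c s Hcs Hs).
Qed.
End Konno.

(** * The eigensystem and the walk *)

Lemma sum_n_3 (f : nat -> C) : sum_n f 3 = (f 0%nat + f 1%nat + f 2%nat + f 3%nat)%C.
Proof. now rewrite !sum_Sn, sum_O. Qed.

Lemma P_entry theta k i j : (i < 4)%nat -> (j < 4)%nat ->
  coeff_mat (RtoC 0) (P theta k) i j =
  (cis (k * (-1) ^ i) * p theta ((j + 4 - i) mod 4))%C.
Proof. intros Hi Hj. unfold P. now rewrite coeff_mat_bij. Qed.

Lemma p_even theta : (p theta 0 - p theta 2 = exp (- theta) * cos theta)%C.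
Proof. rewrite <- RtoC_minus, <- RtoC_mult. f_equal. unfold p. field. Qed.

Lemma p_odd theta : (p theta 1 - p theta 3 = exp (- theta) * sin theta)%C.
Proof. rewrite <- RtoC_minus, <- RtoC_mult. f_equal. unfold p. field. Qed.

Local Ltac reduce_mod H := repeat match type of H with
  context [Nat.modulo ?a ?b] =>
    let m := eval vm_compute in (Nat.modulo a b) in change (Nat.modulo a b) with m in H
  end.

(** An antisymmetric vector is determined by its entries 0 and 1, and only the
    differences [p_0 - p_2] and [p_1 - p_3] act on it: this is the matrix [B]. *)
Lemma right_eigenvector_B theta k lam v :
  right_eigenvector (P theta k) lam v -> in_span v ->
  (lam * cval v 0 = cis k * (exp (- theta) * cos theta) * cval v 0
                    + cis k * (exp (- theta) * sin theta) * cval v 1)%C /\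
  (lam * cval v 1 = - cis (- k) * (exp (- theta) * sin theta) * cval v 0
                    + cis (- k) * (exp (- theta) * cos theta) * cval v 1)%C /\
  (cval v 2 = - cval v 0)%C /\ (cval v 3 = - cval v 1)%C.
Proof.
  intros [_ H] [a [b Hv]].
  assert (Hi : forall i, (i < 4)%nat -> (lam * cval v i =
    cis (k * (-1) ^ i) * p theta ((0 + 4 - i) mod 4) * cval v 0 +
    cis (k * (-1) ^ i) * p theta ((1 + 4 - i) mod 4) * cval v 1 +
    cis (k * (-1) ^ i) * p theta ((2 + 4 - i) mod 4) * cval v 2 +
    cis (k * (-1) ^ i) * p theta ((3 + 4 - i) mod 4) * cval v 3)%C).
  { intros i Hi.
    apply (f_equal (fun A : @matrix C 4 1 => coeff_mat (RtoC 0) A i 0)) in H.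
    unfold mscal in H. rewrite coeff_mat_bij in H by lia. unfold cval. rewrite <- H.
    unfold Mmult. rewrite coeff_mat_bij by lia. simpl Init.Nat.pred.
    rewrite sum_n_3. change (@mult C_Ring) with Cmult. change (@zero C_Ring) with (RtoC 0).
    now rewrite !P_entry by lia. }
  assert (H2 : cval v 2 = (- cval v 0)%C) by (rewrite Hv; cbn; ring).
  assert (H3 : cval v 3 = (- cval v 1)%C) by (rewrite Hv; cbn; ring).
  pose proof (Hi 0%nat ltac:(lia)) as E0. pose proof (Hi 1%nat ltac:(lia)) as E1.
  rewrite H2, H3 in E0, E1.
  reduce_mod E0. reduce_mod E1.
  replace (k * (-1) ^ 0) with k in E0 by ring.
  replace (k * (-1) ^ 1) with (- k) in E1 by ring.
  rewrite <- p_even, <- p_odd.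
  repeat split; [rewrite E0; ring|rewrite E1; ring|exact H2|exact H3].
Qed.

Lemma left_eigenvector_B theta k lam w :
  left_eigenvector (P theta k) lam w ->
  rval w 0 = (- rval w 2)%C -> rval w 1 = (- rval w 3)%C ->
  (lam * rval w 0 = cis k * (exp (- theta) * cos theta) * rval w 0
                    + - cis (- k) * (exp (- theta) * sin theta) * rval w 1)%C /\
  (lam * rval w 1 = cis k * (exp (- theta) * sin theta) * rval w 0
                    + cis (- k) * (exp (- theta) * cos theta) * rval w 1)%C.
Proof.
  intros [_ H] H2 H3.
  assert (Hi : forall i, (i < 4)%nat -> (lam * rval w i =
    rval w 0 * (cis (k * (-1) ^ 0) * p theta ((i + 4 - 0) mod 4)) +
    rval w 1 * (cis (k * (-1) ^ 1) * p theta ((i + 4 - 1) mod 4)) +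
    rval w 2 * (cis (k * (-1) ^ 2) * p theta ((i + 4 - 2) mod 4)) +
    rval w 3 * (cis (k * (-1) ^ 3) * p theta ((i + 4 - 3) mod 4)))%C).
  { intros i Hi.
    apply (f_equal (fun A : @matrix C 1 4 => coeff_mat (RtoC 0) A 0 i)) in H.
    unfold mscal in H. rewrite coeff_mat_bij in H by lia. unfold rval. rewrite <- H.
    unfold Mmult. rewrite coeff_mat_bij by lia. simpl Init.Nat.pred.
    rewrite sum_n_3. change (@mult C_Ring) with Cmult. change (@zero C_Ring) with (RtoC 0).
    now rewrite !P_entry by lia. }
  assert (H2' : rval w 2 = (- rval w 0)%C) by (rewrite H2; ring).
  assert (H3' : rval w 3 = (- rval w 1)%C) by (rewrite H3; ring).
  pose proof (Hi 0%nat ltac:(lia)) as E0. pose proof (Hi 1%nat ltac:(lia)) as E1.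
  rewrite H2', H3' in E0, E1.
  reduce_mod E0. reduce_mod E1.
  replace (k * (-1) ^ 0) with k in E0, E1 by ring.
  replace (k * (-1) ^ 1) with (- k) in E0, E1 by ring.
  replace (k * (-1) ^ 2) with k in E0, E1 by ring.
  replace (k * (-1) ^ 3) with (- k) in E0, E1 by ring.
  rewrite <- p_even, <- p_odd.
  split; [rewrite E0; ring|rewrite E1; ring].
Qed.

Lemma Cmult_reg_r (x y d : C) : d <> RtoC 0 -> (x * d = y * d)%C -> x = y.
Proof.
  intros Hd H. replace x with (x * d / d)%C by (field; exact Hd).
  rewrite H. field. exact Hd.
Qed.

(** Left and right eigenvectors of a 2 x 2 matrix for distinct eigenvalues are
    biorthogonal.  A one-sided inverse of a square matrix being two-sided, the
    rank one projectors [a_j g_j] resolve the identity (here halved by the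
    normalization); applying the matrix once more determines their first row. *)
Lemma projector_first_row (b00 b01 b10 b11 m1 m2 a1 d1 g1 h1 a2 d2 g2 h2 : C) :
  m1 <> m2 ->
  (m1 * a1 = b00 * a1 + b01 * d1)%C -> (m1 * d1 = b10 * a1 + b11 * d1)%C ->
  (m2 * a2 = b00 * a2 + b01 * d2)%C -> (m2 * d2 = b10 * a2 + b11 * d2)%C ->
  (m1 * g1 = b00 * g1 + b10 * h1)%C -> (m1 * h1 = b01 * g1 + b11 * h1)%C ->
  (m2 * g2 = b00 * g2 + b10 * h2)%C -> (m2 * h2 = b01 * g2 + b11 * h2)%C ->
  (2 * (g1 * a1 + h1 * d1) = 1)%C -> (2 * (g2 * a2 + h2 * d2) = 1)%C ->
  (a1 * g1 * (2 * (m1 - m2)) = b00 - m2)%C /\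
  (a2 * g2 * (2 * (m2 - m1)) = b00 - m1)%C /\
  (a1 * h1 * (2 * (m1 - m2)) = b01)%C /\
  (a2 * h2 * (2 * (m2 - m1)) = b01)%C.
Proof.
  intros Hm R1 S1 R2 S2 L1 K1 L2 K2 N1 N2.
  assert (Hd : (m1 - m2)%C <> RtoC 0).
  { intros E. apply Hm. replace m1 with (m1 - m2 + m2)%C by ring. rewrite E. ring. }
  assert (O1 : (g1 * a2 + h1 * d2 = 0)%C).
  { apply (Cmult_reg_r _ _ (m1 - m2)%C Hd).
    transitivity ((m1 * g1) * a2 + (m1 * h1) * d2 - g1 * (m2 * a2) - h1 * (m2 * d2))%C; [ring|].
    rewrite L1, K1, R2, S2. ring. }
  assert (O2 : (g2 * a1 + h2 * d1 = 0)%C).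
  { apply (Cmult_reg_r _ _ (m1 - m2)%C Hd).
    transitivity (- ((m2 * g2) * a1 + (m2 * h2) * d1) + g2 * (m1 * a1) + h2 * (m1 * d1))%C; [ring|].
    rewrite L2, K2, R1, S1. ring. }
  (* The determinant of the right eigenvectors; its product with that of the left
     eigenvectors is [1 / 4] by the normalization and biorthogonality. *)
  set (D := (a1 * d2 - a2 * d1)%C).
  assert (HD : D <> RtoC 0).
  { intros E. apply C1_nz.
    transitivity (2 * (g1 * a1 + h1 * d1) * (2 * (g2 * a2 + h2 * d2))
      - 4 * ((g1 * a2 + h1 * d2) * (g2 * a1 + h2 * d1)))%C.
    - rewrite N1, N2, O1, O2. ring.
    - transitivity (4 * (g1 * h2 - g2 * h1) * D)%C; [unfold D; ring|]. rewrite E. ring. }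
  assert (E0 : (2 * (a1 * g1 + a2 * g2) = 1)%C).
  { apply (Cmult_reg_r _ _ D HD).
    transitivity (a1 * d2 * (2 * (g1 * a1 + h1 * d1)) - 2 * (a1 * d1 * (g1 * a2 + h1 * d2))
       + 2 * (a2 * d2 * (g2 * a1 + h2 * d1)) - a2 * d1 * (2 * (g2 * a2 + h2 * d2)))%C;
      [unfold D; ring|].
    rewrite N1, N2, O1, O2. unfold D. ring. }
  assert (E1 : (a1 * h1 + a2 * h2 = 0)%C).
  { apply (Cmult_reg_r _ _ (2 * D)%C).
    { intros E. apply HD. replace D with (/ 2 * (2 * D))%C by (field; apply RtoC_neq; lra).
      rewrite E. ring. }
    transitivity (2 * (a1 * a1 * (g1 * a2 + h1 * d2)) - a1 * a2 * (2 * (g1 * a1 + h1 * d1))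
       + a1 * a2 * (2 * (g2 * a2 + h2 * d2)) - 2 * (a2 * a2 * (g2 * a1 + h2 * d1)))%C;
      [unfold D; ring|].
    rewrite N1, N2, O1, O2. ring. }
  assert (F0 : (2 * (a1 * (m1 * g1) + a2 * (m2 * g2)) = b00)%C).
  { rewrite L1, L2.
    transitivity (b00 * (2 * (a1 * g1 + a2 * g2)) + 2 * b10 * (a1 * h1 + a2 * h2))%C; [ring|].
    rewrite E0, E1. ring. }
  assert (F1 : (2 * (a1 * (m1 * h1) + a2 * (m2 * h2)) = b01)%C).
  { rewrite K1, K2.
    transitivity (b01 * (2 * (a1 * g1 + a2 * g2)) + 2 * b11 * (a1 * h1 + a2 * h2))%C; [ring|].
    rewrite E0, E1. ring. }
  rewrite <- F0, <- F1. repeat split.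
  - transitivity (2 * (a1 * (m1 * g1) + a2 * (m2 * g2)) - m2 * (2 * (a1 * g1 + a2 * g2)))%C;
      [ring|rewrite E0; ring].
  - transitivity (2 * (a1 * (m1 * g1) + a2 * (m2 * g2)) - m1 * (2 * (a1 * g1 + a2 * g2)))%C;
      [ring|rewrite E0; ring].
  - transitivity (2 * (a1 * (m1 * h1) + a2 * (m2 * h2)) - 2 * m2 * (a1 * h1 + a2 * h2))%C;
      [ring|rewrite E1; ring].
  - transitivity (2 * (a1 * (m1 * h1) + a2 * (m2 * h2)) - 2 * m1 * (a1 * h1 + a2 * h2))%C;
      [ring|rewrite E1; ring].
Qed.

Definition polar (x a : R) : C := (x * cos a, x * sin a).

Lemma polar_pow x a n : (polar x a ^ n)%C = polar (x ^ n) (INR n * a).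
Proof.
  induction n as [|n IH].
  - unfold polar. simpl. rewrite Rmult_0_l, cos_0, sin_0. apply injective_projections; simpl; ring.
  - rewrite Cpow_S, IH, S_INR, Rmult_plus_distr_r, Rmult_1_l. unfold polar.
    rewrite cos_plus, sin_plus. apply injective_projections; simpl; ring.
Qed.

Lemma exp_decay_pow n theta : exp (2 * INR n * theta) * (exp (- theta) ^ n) ^ 2 = 1.
Proof.
  induction n as [|n IH].
  - simpl. rewrite Rmult_0_r, Rmult_0_l, exp_0. ring.
  - rewrite S_INR.
    replace (2 * (INR n + 1) * theta) with (2 * INR n * theta + (theta + theta)) by ring.
    rewrite !exp_plus. simpl (exp (- theta) ^ S n).
    assert (E : exp theta * exp (- theta) = 1) by (rewrite <- exp_plus, Rplus_opp_r; apply exp_0).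
    transitivity (exp (2 * INR n * theta) * (exp (- theta) ^ n) ^ 2
      * (exp theta * exp (- theta)) ^ 2); [ring|]. rewrite IH, E. ring.
Qed.

(** Continuity of both components, the form in which integrability of complex
    valued functions is established. *)
Definition Ccont (f : R -> C) : Prop :=
  (forall x : R, continuous (fun y => fst (f y)) x) /\
  (forall x : R, continuous (fun y => snd (f y)) x).

Lemma Ccont_mult f g : Ccont f -> Ccont g -> Ccont (fun x => f x * g x)%C.
Proof.
  intros [F1 F2] [G1 G2]. split; intros x; simpl.
  - apply (continuous_minus (V := R_NormedModule)); apply (continuous_mult (K := R_AbsRing)); auto.
  - apply (continuous_plus (V := R_NormedModule)); apply (continuous_mult (K := R_AbsRing)); auto.
Qed.

Lemma is_RInt_Cpair (f : R -> C) a b x y :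
  is_RInt (fun t => fst (f t)) a b x -> is_RInt (fun t => snd (f t)) a b y ->
  is_RInt (V := C_R_NormedModule) f a b ((x, y) : C).
Proof.
  exact (is_RInt_fct_extend_pair (U := R_NormedModule) (V := R_NormedModule) f a b x y).
Qed.

Lemma ex_RInt_Ccont f a b : Ccont f -> ex_RInt (V := C_R_NormedModule) f a b.
Proof.
  intros [F1 F2].
  destruct (ex_RInt_cont (fun y => fst (f y)) a b F1) as [x Hx].
  destruct (ex_RInt_cont (fun y => snd (f y)) a b F2) as [y Hy].
  exists ((x, y) : C). now apply is_RInt_Cpair.
Qed.

Section Spectral.
Variable theta : R.
Hypothesis Hc : 0 < cos theta.
Hypothesis Hs : sin theta <> 0.
Notation c := (cos theta).
Notation s := (sin theta).

Let Hcs : c ^ 2 + s ^ 2 = 1.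
Proof. pose proof (sin2_cos2 theta) as H. unfold Rsqr in H. lra. Qed.

Definition branch (j : nat) (k : R) : R :=
  match j with 1%nat => phase c k | _ => - phase c k end.

Lemma lambdaB_polar j k : lambdaB theta j k = polar (exp (- theta)) (branch j k).
Proof.
  assert (E : sin (phase c k) = sqrt (1 - cos k ^ 2 * c ^ 2)).
  { unfold phase. rewrite sin_acos by (pose proof (ccos_bounds c s Hcs Hs k); lra).
    f_equal. unfold Rsqr. ring. }
  unfold lambdaB, polar, branch. rewrite <- E.
  destruct j as [|[|j]]; rewrite ?cos_neg, ?sin_neg, (cos_phase c s Hcs Hs);
    apply injective_projections; simpl; ring.
Qed.

(** The first row of the spectral projectors of [B], halved.  The momentum
    dependence of the eigenvectors themselves is arbitrary; this combination is
    not, and it is continuous in [k]. *)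
Definition projector (j site : nat) (k : R) : C :=
  let x := match j with 1%nat => / 4 | _ => - / 4 end in
  match site with
  | O => (/ 4 + x * vel c k, 0)
  | _ => (x * (s * csc_phase c k * sin k), - x * (s * csc_phase c k * cos k))
  end.

Definition amplitude (site : nat) : nat -> Z -> R :=
  match site with O => ampA c s | _ => ampB c s end.

Definition is_site (site : nat) : Prop := site = 0%nat \/ site = 1%nat.

Lemma projector_evolution site n k : is_site site ->
  (projector 1 site k * polar (exp (- theta) ^ n) (INR n * branch 1 k) +
   projector 2 site k * polar (exp (- theta) ^ n) (INR n * branch 2 k))%C =
  (exp (- theta) ^ n / 2 * cosum n (amplitude site n) k,
   exp (- theta) ^ n / 2 * sisum n (amplitude site n) k).
Proof.
  intros Hsite.
  destruct (walk_sums_closed c s Hcs Hs k n n (Nat.le_refl n)) as (H1 & H2 & H3 & H4).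
  unfold polar, branch. rewrite Ropp_mult_distr_r_reverse, cos_neg, sin_neg.
  destruct Hsite as [-> | ->]; unfold projector, amplitude;
    rewrite ?H1, ?H2, ?H3, ?H4; apply injective_projections; simpl; field.
Qed.

Lemma Ccont_evolution j site n t : is_site site ->
  Ccont (fun k => projector j site k * polar (exp (- theta) ^ n) (INR n * branch j k)
                  * cis (- (k * IZR t)))%C.
Proof.
  intros Hsite.
  assert (Hb : forall x : R, ex_derive (branch j) x).
  { intros x. destruct j as [|[|j]].
    1, 3: apply (ex_derive_opp (V := R_NormedModule) (phase c)).
    all: eexists; apply (is_derive_phase c s Hcs Hs). }
  apply Ccont_mult; [apply Ccont_mult|].
  - destruct Hsite as [-> | ->]; unfold projector; split; intros x; simpl.
    + exact (continuous_eval c s Hcs Hs (Add (Cst (/ 4))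
        (Mul (Cst (match j with 1%nat => / 4 | _ => - / 4 end)) (vel_trig c))) 0 x).
    + apply (continuous_const (V := R_UniformSpace)).
    + exact (continuous_eval c s Hcs Hs (Mul (Cst (match j with 1%nat => / 4 | _ => - / 4 end))
        (Mul (Mul (Cst s) CscPhase) SinK)) 0 x).
    + exact (continuous_eval c s Hcs Hs (Mul (Cst (- match j with 1%nat => / 4 | _ => - / 4 end))
        (Mul (Mul (Cst s) CscPhase) CosK)) 0 x).
  - unfold polar. split; intros x; simpl; apply (ex_derive_continuous (V := R_NormedModule));
      auto_derive; auto.
  - unfold cis. split; intros x; simpl; apply (ex_derive_continuous (V := R_NormedModule));
      auto_derive; auto.
Qed.

Variable r : nat -> R -> @matrix C 4 1.
Variable l : nat -> R -> @matrix C 1 4.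
Hypothesis HB : B_eigensystem theta r l.

(** By [projector_first_row] the product depends only on the eigenvalues and on
    the first row of [B]; the eigenvalues are distinct because [sin phi <> 0]. *)
Lemma projector_eigensystem j site k : j = 1%nat \/ j = 2%nat -> is_site site ->
  - PI < k < PI ->
  (cval (r j k) 0 * rval (l j k) site)%C = projector j site k.
Proof.
  intros Hj Hsite Hk.
  destruct (HB 1%nat k (or_introl eq_refl) Hk) as (R1 & S1 & L1 & A1 & B1 & N1).
  destruct (HB 2%nat k (or_intror eq_refl) Hk) as (R2 & S2 & L2 & A2 & B2 & N2).
  destruct (right_eigenvector_B _ _ _ _ R1 S1) as (R10 & R11 & R12 & R13).
  destruct (right_eigenvector_B _ _ _ _ R2 S2) as (R20 & R21 & R22 & R23).
  destruct (left_eigenvector_B _ _ _ _ L1 A1 B1) as (L10 & L11).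
  destruct (left_eigenvector_B _ _ _ _ L2 A2 B2) as (L20 & L21).
  rewrite sum_n_3, R12, R13 in N1. rewrite sum_n_3, R22, R23 in N2.
  rewrite A1, B1 in N1. rewrite A2, B2 in N2.
  rewrite lambdaB_polar in *.
  pose proof (csc_phase_pos c s Hcs Hs k) as Hi.
  pose proof (sin_phase c s Hcs Hs k) as Hsi.
  pose proof (cos_phase c s Hcs Hs k) as Hci.
  pose proof (exp_pos (- theta)) as HE.
  assert (Hsp : sin (phase c k) = / csc_phase c k).
  { apply (Rmult_eq_reg_r (csc_phase c k)); [|lra]. rewrite Hsi. field. lra. }
  assert (Hsp0 : 0 < / csc_phase c k) by now apply Rinv_0_lt_compat.
  assert (Hm : polar (exp (- theta)) (branch 1 k) <> polar (exp (- theta)) (branch 2 k)).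
  { unfold polar, branch. rewrite sin_neg, Hsp. intros E. injection E as _ E. nra. }
  destruct (projector_first_row _ _ _ _ _ _ _ _ _ _ _ _ _ _ Hm R10 R11 R20 R21 L10 L11 L20 L21)
    as (Q1 & Q2 & Q3 & Q4).
  { rewrite <- N1, A1, B1. ring. }
  { rewrite <- N2, A2, B2. ring. }
  assert (Hd : (2 * (polar (exp (- theta)) (branch 1 k) - polar (exp (- theta)) (branch 2 k)))%C <> RtoC 0).
  { unfold polar, branch. rewrite sin_neg, Hsp. intros E.
    apply (f_equal snd) in E. simpl in E. nra. }
  assert (Hd' : (2 * (polar (exp (- theta)) (branch 2 k) - polar (exp (- theta)) (branch 1 k)))%C <> RtoC 0).
  { unfold polar, branch. rewrite sin_neg, Hsp. intros E.
    apply (f_equal snd) in E. simpl in E. nra. }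
  destruct Hj as [-> | ->];
    [apply (Cmult_reg_r _ _ _ Hd)|apply (Cmult_reg_r _ _ _ Hd')];
    (destruct Hsite as [-> | ->]; [rewrite ?Q1, ?Q2|rewrite ?Q3, ?Q4]);
    unfold polar, branch, cis, projector, vel; rewrite ?cos_neg, ?sin_neg, Hci, Hsp;
    apply injective_projections; simpl; field; lra.
Qed.

(** The two integrals are combined into one before the Fourier coefficient is
    read off; that each exists is [Ccont_evolution]. *)
Lemma I_B_sum_amplitude n site t : is_site site ->
  (- Z.of_nat n <= t <= Z.of_nat n)%Z ->
  I_B_sum theta r l n site t = RtoC (exp (- theta) ^ n / 2 * amplitude site n t).
Proof.
  intros Hsite Ht. pose proof PI_RGT_0 as HPI.
  set (F := fun (j : nat) k => (projector j site k * polar (exp (- theta) ^ n) (INR n * branch j k)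
                  * cis (- (k * IZR t)))%C).
  assert (HI : forall j, j = 1%nat \/ j = 2%nat ->
    I_B theta r l n site t j = ((1 / (2 * PI))%R * RInt (V := C_R_CompleteNormedModule) (F j) (- PI) PI)%C).
  { intros j Hj. unfold I_B. f_equal. apply (RInt_ext (V := C_R_CompleteNormedModule)).
    rewrite Rmin_left, Rmax_right by lra. intros k Hk.
    unfold F. now rewrite lambdaB_polar, polar_pow, (projector_eigensystem j site k Hj Hsite Hk). }
  assert (HF : forall j, is_RInt (V := C_R_NormedModule) (F j) (- PI) PI
     (RInt (V := C_R_CompleteNormedModule) (F j) (- PI) PI)).
  { intros j. apply (RInt_correct (V := C_R_CompleteNormedModule)), ex_RInt_Ccont.
    now apply Ccont_evolution. }
  pose proof (is_RInt_plus (V := C_R_NormedModule) _ _ _ _ _ _ (HF 1%nat) (HF 2%nat)) as HS.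
  set (a := exp (- theta) ^ n / 2).
  assert (HG : is_RInt (V := C_R_NormedModule) (fun k => plus (F 1%nat k) (F 2%nat k)) (- PI) PI
    ((a * (2 * PI * amplitude site n t), a * 0) : C)).
  { apply is_RInt_Cpair.
    - apply (is_RInt_ext (fun k => a * (cos (k * IZR t) * cosum n (amplitude site n) k
         + sin (k * IZR t) * sisum n (amplitude site n) k))).
      2: { apply (is_RInt_scal (V := R_NormedModule)). now apply fourier_coef_re. }
      intros k _. change (plus (F 1%nat k) (F 2%nat k)) with (F 1%nat k + F 2%nat k)%C.
      unfold F. rewrite <- Cmult_plus_distr_r, projector_evolution by exact Hsite.
      unfold cis. rewrite cos_neg, sin_neg. fold a. simpl. ring.
    - apply (is_RInt_ext (fun k => a * (cos (k * IZR t) * sisum n (amplitude site n) k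
         - sin (k * IZR t) * cosum n (amplitude site n) k))).
      2: { apply (is_RInt_scal (V := R_NormedModule)), fourier_coef_im. }
      intros k _. change (plus (F 1%nat k) (F 2%nat k)) with (F 1%nat k + F 2%nat k)%C.
      unfold F. rewrite <- Cmult_plus_distr_r, projector_evolution by exact Hsite.
      unfold cis. rewrite cos_neg, sin_neg. fold a. simpl. ring. }
  unfold I_B_sum. rewrite sum_n_Sm, sum_n_n by lia.
  rewrite (HI 1%nat), (HI 2%nat) by auto.
  change plus with Cplus. rewrite <- Cmult_plus_distr_l.
  transitivity ((1 / (2 * PI))%R * ((a * (2 * PI * amplitude site n t))%R, (a * 0)%R))%C.
  - f_equal. 
    rewrite <- (is_RInt_unique (V := C_R_CompleteNormedModule) _ _ _ _ HG).
    symmetry. exact (is_RInt_unique (V := C_R_CompleteNormedModule) _ _ _ _ HS).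
  - apply injective_projections; simpl; field; lra.
Qed.
End Spectral.

(** * Integrals of step functions and conclusion *)

(** On the cell between [t / n] and [(t + 1) / n] the integrand has the constant
    value [g (t + 1)]. *)
Lemma is_RInt_step (g : Z -> R) n a len : (1 <= n)%nat ->
  is_RInt (fun x => g (Zceil (x * INR n)))
    (1 / INR n * IZR a) (1 / INR n * IZR (a + Z.of_nat len))
    (1 / INR n * zsum g (a + 1) len).
Proof.
  intros Hn. assert (Hn1 : 0 < INR n) by (apply lt_0_INR; lia).
  assert (Hi : 0 < 1 / INR n) by (apply Rdiv_lt_0_compat; lra).
  revert a. induction len as [|len IH]; intros a.
  - rewrite Z.add_0_r. simpl. rewrite Rmult_0_r.
    apply (is_RInt_point (V := R_NormedModule)).
  - simpl zsum. rewrite Rmult_plus_distr_l.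
    apply (is_RInt_Chasles (V := R_NormedModule)) with (1 / INR n * IZR (a + 1)).
    + apply (is_RInt_ext (fun _ => g (a + 1)%Z)).
      * rewrite plus_IZR, Rmin_left, Rmax_right by nra.
        intros x Hx. f_equal. symmetry. apply Zceil_eq. rewrite plus_IZR.
        assert (E : forall y, 1 / INR n * y * INR n = y) by (intros; field; lra).
        split; [|apply Rlt_le].
        -- rewrite <- (E (IZR a + 1 - 1)). apply Rmult_lt_compat_r; [lra|].
           replace (IZR a + 1 - 1) with (IZR a) by ring. lra.
        -- rewrite <- (E (IZR a + 1)). apply Rmult_lt_compat_r; lra.
      * evar_last; [apply (is_RInt_const (V := R_NormedModule))|].
        unfold scal; simpl; unfold mult; simpl. rewrite plus_IZR. ring.
    + replace (a + Z.of_nat (S len))%Z with (a + 1 + Z.of_nat len)%Z by lia. apply IH.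
Qed.

Lemma Zceil_cell n a b x : (1 <= n)%nat ->
  1 / INR n * IZR a < x < 1 / INR n * IZR b -> (a < Zceil (x * INR n) <= b)%Z.
Proof.
  intros Hn Hx. assert (Hn1 : 0 < INR n) by (apply lt_0_INR; lia).
  assert (E : forall y, 1 / INR n * y * INR n = y) by (intros; field; lra).
  pose proof (Zceil_bound (x * INR n)) as Hb.
  assert (IZR a < x * INR n) by (rewrite <- (E (IZR a)); apply Rmult_lt_compat_r; lra).
  assert (x * INR n < IZR b) by (rewrite <- (E (IZR b)); apply Rmult_lt_compat_r; lra).
  split; [apply lt_IZR; lra|].
  assert (Zceil (x * INR n) - 1 < b)%Z by (apply lt_IZR; rewrite minus_IZR; lra). lia.
Qed.

Lemma is_RInt_block (f : R -> R) (g : Z -> R) n a b : (1 <= n)%nat -> (a <= b)%Z ->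
  (forall x, (a < Zceil (x * INR n) <= b)%Z -> f x = g (Zceil (x * INR n))) ->
  is_RInt f (1 / INR n * IZR a) (1 / INR n * IZR b)
    (1 / INR n * zsum g (a + 1) (Z.to_nat (b - a))).
Proof.
  intros Hn Hab H. assert (Hn1 : 0 < INR n) by (apply lt_0_INR; lia).
  assert (Hi : 0 < 1 / INR n) by (apply Rdiv_lt_0_compat; lra).
  assert (HZ : IZR a <= IZR b) by now apply IZR_le.
  pose proof (is_RInt_step g n a (Z.to_nat (b - a)) Hn) as HS.
  replace (a + Z.of_nat (Z.to_nat (b - a)))%Z with b in HS by lia.
  eapply is_RInt_ext; [|exact HS].
  rewrite Rmin_left, Rmax_right by nra. intros x Hx. symmetry. apply H.
  now apply Zceil_cell.
Qed.

Lemma Zfloor_light_cone n y : (1 <= n)%nat -> -1 <= y <= 1 ->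
  (- Z.of_nat n <= Zfloor (INR n * y) <= Z.of_nat n)%Z.
Proof.
  intros Hn Hy. assert (Hn1 : 0 < INR n) by (apply lt_0_INR; lia).
  pose proof (Zfloor_bound (INR n * y)) as Hb. split.
  - apply Zfloor_lub. rewrite opp_IZR, <- INR_IZR_INZ. nra.
  - apply le_IZR. rewrite <- INR_IZR_INZ. nra.
Qed.

Lemma mean_below c s al be y n : (1 <= n)%nat -> -1 <= y <= 1 ->
  walk_mean c s al be (below y) n =
  zsum (fun t => psi c s al be n t ^ 2) (- Z.of_nat n)
    (Z.to_nat (Zfloor (INR n * y) + Z.of_nat n + 1)).
Proof.
  intros Hn Hy. assert (Hn1 : 0 < INR n) by (apply lt_0_INR; lia).
  pose proof (Zfloor_bound (INR n * y)) as Hb.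
  pose proof (Zfloor_light_cone n y Hn Hy) as Hcone.
  unfold walk_mean, window_sum.
  set (l1 := Z.to_nat (Zfloor (INR n * y) + Z.of_nat n + 1)).
  replace (2 * n + 1)%nat with (l1 + (2 * n + 1 - l1))%nat by lia.
  rewrite zsum_cat, (zsum_zero _ (2 * n + 1 - l1)), Rplus_0_r.
  - apply zsum_ext. intros t Ht. unfold below. destruct Rle_dec as [_|N]; [ring|].
    exfalso. apply N. apply (Rmult_le_reg_r (INR n)); [lra|].
    unfold Rdiv. rewrite Rmult_assoc, Rinv_l by lra.
    assert (IZR t <= IZR (Zfloor (INR n * y))) by (apply IZR_le; lia). lra.
  - intros t Ht. unfold below. destruct Rle_dec as [N|_]; [|ring].
    exfalso. apply (Rmult_le_compat_r (INR n)) in N; [|lra].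
    unfold Rdiv in N. rewrite Rmult_assoc, Rinv_l in N by lra.
    assert (IZR (Zfloor (INR n * y) + 1) <= IZR t) by (apply IZR_le; lia).
    rewrite plus_IZR in H. lra.
Qed.

Definition block (y1 y2 : R) (n : nat) (g : Z -> R) : R :=
  zsum g (Zfloor (INR n * y1) + 1) (Z.to_nat (Zfloor (INR n * y2) - Zfloor (INR n * y1))).

Section Conclusion.
Variable theta : R.
Hypothesis Hc : 0 < cos theta.
Hypothesis Hs : sin theta <> 0.
Variables y1 y2 : R.
Hypothesis Hy1 : - cos theta < y1.
Hypothesis Hy : y1 < y2.
Hypothesis Hy2 : y2 < cos theta.
Notation c := (cos theta).
Notation s := (sin theta).
Notation A := (ampA c s).
Notation B := (ampB c s).

Lemma block_limit al be :
  is_lim_seq (fun n => block y1 y2 n (fun t => psi c s al be n t ^ 2))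
    (/ 2 * RInt (fun a => weight c s al be a * fK a theta) y1 y2).
Proof.
  pose proof (COS_bound theta) as Hb.
  apply (is_lim_seq_ext_loc (fun n => walk_mean c s al be (below y2) n
                                      - walk_mean c s al be (below y1) n));
    [|now apply walk_interval_limit].
  exists 1%nat. intros n Hn. assert (Hn1 : 0 < INR n) by (apply lt_0_INR; lia).
  rewrite !mean_below by (auto; lra).
  pose proof (Zfloor_light_cone n y1 Hn ltac:(lra)) as Hcone.
  assert (H2 : (Zfloor (INR n * y1) <= Zfloor (INR n * y2))%Z).
  { apply Zfloor_le. nra. }
  unfold block.
  set (u := Zfloor (INR n * y1)) in *. set (w := Zfloor (INR n * y2)) in *.
  replace (Z.to_nat (w + Z.of_nat n + 1))
    with (Z.to_nat (u + Z.of_nat n + 1) + Z.to_nat (w - u))%nat by lia.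
  rewrite zsum_cat.
  replace (- Z.of_nat n + Z.of_nat (Z.to_nat (u + Z.of_nat n + 1)))%Z with (u + 1)%Z by lia.
  ring.
Qed.

Lemma ex_RInt_fK f : (forall x : R, continuous f x) ->
  ex_RInt (fun a => f a * fK a theta) y1 y2.
Proof.
  intros Hf. apply (ex_RInt_continuous (V := R_CompleteNormedModule)).
  rewrite Rmin_left, Rmax_right by lra. intros y Hyy.
  apply (continuous_mult (K := R_AbsRing)); [apply Hf|]. apply continuous_fK; lra.
Qed.

Lemma block_limit_AA :
  is_lim_seq (fun n => block y1 y2 n (fun t => A n t ^ 2))
    (/ 2 * RInt (fun a => (1 + a) ^ 2 * fK a theta) y1 y2).
Proof.
  rewrite (RInt_Rext _ (fun a => weight c s 1 0 a * fK a theta))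
    by (intros; unfold weight; ring).
  eapply is_lim_seq_ext; [|apply (block_limit 1 0)].
  intros n. apply zsum_ext. intros t _. unfold psi. ring.
Qed.

Lemma block_limit_BB :
  is_lim_seq (fun n => block y1 y2 n (fun t => B n t ^ 2))
    (/ 2 * RInt (fun a => (1 - a ^ 2) * fK a theta) y1 y2).
Proof.
  rewrite (RInt_Rext _ (fun a => weight c s 0 1 a * fK a theta))
    by (intros; unfold weight; ring).
  eapply is_lim_seq_ext; [|apply (block_limit 0 1)].
  intros n. apply zsum_ext. intros t _. unfold psi. ring.
Qed.

(** Polarization: [2 A B = (A + B)^2 - A^2 - B^2]. *)
Lemma block_limit_AB :
  is_lim_seq (fun n => block y1 y2 n (fun t => A n t * B n t))
    (/ 2 * RInt (fun a => a * (1 + a) * tan theta * fK a theta) y1 y2).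
Proof.
  apply (is_lim_seq_ext (fun n => / 2 * (block y1 y2 n (fun t => psi c s 1 1 n t ^ 2)
    - block y1 y2 n (fun t => A n t ^ 2) - block y1 y2 n (fun t => B n t ^ 2)))).
  - intros n. unfold block, Rminus.
    rewrite <- (Rmult_1_l (zsum (fun t => A n t ^ 2) _ _)),
      <- (Rmult_1_l (zsum (fun t => B n t ^ 2) _ _)), !Ropp_mult_distr_l.
    rewrite <- !zsum_scal, <- !zsum_plus, <- zsum_scal.
    apply zsum_ext. intros t _. unfold psi. field.
  - set (WA := RInt (fun a => (1 + a) ^ 2 * fK a theta) y1 y2).
    set (WB := RInt (fun a => (1 - a ^ 2) * fK a theta) y1 y2).
    set (W := RInt (fun a => weight c s 1 1 a * fK a theta) y1 y2).
    replace (/ 2 * RInt (fun a => a * (1 + a) * tan theta * fK a theta) y1 y2)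
      with (/ 2 * (/ 2 * W - / 2 * WA - / 2 * WB)).
    + apply (is_lim_seq_scal_l _ (/ 2) (/ 2 * W - / 2 * WA - / 2 * WB)).
      apply is_lim_seq_minus'; [apply is_lim_seq_minus'|].
      * apply block_limit.
      * apply block_limit_AA.
      * apply block_limit_BB.
    + assert (Hpoly : forall f : R -> R, (forall x, ex_derive f x) ->
        ex_RInt (fun a => f a * fK a theta) y1 y2).
      { intros f Hf. apply ex_RInt_fK. intros x.
        apply (ex_derive_continuous (V := R_NormedModule)), Hf. }
      assert (EA : ex_RInt (fun a => (1 + a) ^ 2 * fK a theta) y1 y2)
        by (apply Hpoly; intros; auto_derive; exact I).
      assert (EB : ex_RInt (fun a => (1 - a ^ 2) * fK a theta) y1 y2)
        by (apply Hpoly; intros; auto_derive; exact I).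
      assert (ET : ex_RInt (fun a => a * (1 + a) * tan theta * fK a theta) y1 y2)
        by (apply Hpoly; intros; auto_derive; exact I).
      assert (EW : W = WA + WB + 2 * RInt (fun a => a * (1 + a) * tan theta * fK a theta) y1 y2).
      { unfold W, WA, WB.
        rewrite <- RInt_Rscal, <- RInt_Rplus, <- RInt_Rplus; auto.
        - apply RInt_Rext. intros a _. unfold weight, tan, Rdiv. ring.
        - apply (ex_RInt_plus (V := R_NormedModule)); auto.
        - apply (ex_RInt_scal (V := R_NormedModule)), ET. }
      rewrite EW. field.
Qed.

Variable r : nat -> R -> @matrix C 4 1.
Variable l : nat -> R -> @matrix C 1 4.
Hypothesis HB : B_eigensystem theta r l.

(** The walk reaches only [|t| <= n]; [I_B_sum_amplitude] requires this range. *)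
Lemma block_in_light_cone n t : (1 <= n)%nat ->
  (Zfloor (INR n * y1) < t <= Zfloor (INR n * y2))%Z ->
  (- Z.of_nat n <= t <= Z.of_nat n)%Z.
Proof.
  intros Hn Ht. pose proof (COS_bound theta) as Hb.
  pose proof (Zfloor_light_cone n y1 Hn ltac:(lra)).
  pose proof (Zfloor_light_cone n y2 Hn ltac:(lra)). lia.
Qed.

(** Multiplication by [n] compensates the width of the cells, and [/ 4] is the
    square of the factor [1 / 2] in [I_B_sum_amplitude]. *)
Lemma lim_RInt_block (F : nat -> R -> R) (g : nat -> Z -> R) L :
  (forall n x, (1 <= n)%nat ->
     (Zfloor (INR n * y1) < Zceil (x * INR n) <= Zfloor (INR n * y2))%Z ->
     F n x = / 4 * g n (Zceil (x * INR n))) ->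
  is_lim_seq (fun n => block y1 y2 n (g n)) (/ 2 * L) ->
  is_lim_seq (fun n => INR n * RInt (F n) (1 / INR n * IZR (Zfloor (INR n * y1)))
    (1 / INR n * IZR (Zfloor (INR n * y2)))) (1 / 8 * L).
Proof.
  intros HF HL.
  apply (is_lim_seq_ext_loc (fun n => / 4 * block y1 y2 n (g n))).
  - exists 1%nat. intros n Hn. assert (Hn1 : 0 < INR n) by (apply lt_0_INR; lia).
    erewrite is_RInt_unique; [|apply (is_RInt_block _ (fun t => / 4 * g n t) n)].
    + unfold block. rewrite zsum_scal. field. lra.
    + exact Hn.
    + apply Zfloor_le. nra.
    + intros x Hx. now apply HF.
  - replace (1 / 8 * L) with (/ 4 * (/ 2 * L)) by field.
    apply (is_lim_seq_scal_l _ (/ 4) (/ 2 * L)), HL.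
Qed.

Lemma I_B_sum_block site n x : is_site site -> (1 <= n)%nat ->
  (Zfloor (INR n * y1) < Zceil (x * INR n) <= Zfloor (INR n * y2))%Z ->
  I_B_sum theta r l n site (Zceil (x * INR n))
  = RtoC (exp (- theta) ^ n / 2 * amplitude theta site n (Zceil (x * INR n))).
Proof.
  intros Hsite Hn Hx. apply I_B_sum_amplitude; auto. now apply block_in_light_cone.
Qed.

Lemma lim_RInt_modulus site L : is_site site ->
  is_lim_seq (fun n => block y1 y2 n (fun t => amplitude theta site n t ^ 2)) (/ 2 * L) ->
  is_lim_seq (fun n => INR n *
    RInt (fun a => exp (2 * INR n * theta) *
                   Cmod (I_B_sum theta r l n site (Zceil (a * INR n))) ^ 2)
      (1 / INR n * IZR (Zfloor (INR n * y1)))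
      (1 / INR n * IZR (Zfloor (INR n * y2)))) (1 / 8 * L).
Proof.
  intros Hsite HL.
  apply (lim_RInt_block (fun n a => exp (2 * INR n * theta) *
    Cmod (I_B_sum theta r l n site (Zceil (a * INR n))) ^ 2)
    (fun n t => amplitude theta site n t ^ 2)); [|exact HL].
  intros n x Hn Hx. rewrite I_B_sum_block by assumption.
  rewrite Cmod_R, pow2_abs.
  transitivity (/ 4 * (exp (2 * INR n * theta) * (exp (- theta) ^ n) ^ 2)
    * amplitude theta site n (Zceil (x * INR n)) ^ 2); [field|].
  rewrite exp_decay_pow. ring.
Qed.

Lemma lim_RInt_correlation L :
  is_lim_seq (fun n => block y1 y2 n (fun t => A n t * B n t)) (/ 2 * L) ->
  filterlim
    (fun n => (INR n *
       RInt (V := C_R_CompleteNormedModule)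
         (fun a => exp (2 * INR n * theta) *
                   I_B_sum theta r l n 0 (Zceil (a * INR n)) *
                   Cconj (I_B_sum theta r l n 1 (Zceil (a * INR n))))
         (1 / INR n * IZR (Zfloor (INR n * y1)))
         (1 / INR n * IZR (Zfloor (INR n * y2))))%C)
    eventually (locally (RtoC (1 / 8 * L))).
Proof.
  intros HL.
  set (F := fun n a => / 4 * (A n (Zceil (a * INR n)) * B n (Zceil (a * INR n)))).
  assert (HF : is_lim_seq (fun n => INR n * RInt (F n) (1 / INR n * IZR (Zfloor (INR n * y1)))
    (1 / INR n * IZR (Zfloor (INR n * y2)))) (1 / 8 * L))
    by (now apply (lim_RInt_block F (fun n t => A n t * B n t))).
  apply (filterlim_ext_loc (fun n => RtoC (INR n * RInt (F n)
    (1 / INR n * IZR (Zfloor (INR n * y1))) (1 / INR n * IZR (Zfloor (INR n * y2)))))).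
  - exists 1%nat. intros n Hn. assert (Hn1 : 0 < INR n) by (apply lt_0_INR; lia).
    assert (Hi : 0 < 1 / INR n) by (apply Rdiv_lt_0_compat; lra).
    assert (Hfl : (Zfloor (INR n * y1) <= Zfloor (INR n * y2))%Z) by (apply Zfloor_le; nra).
    assert (HZ := IZR_le _ _ Hfl).
    rewrite RtoC_mult. f_equal. symmetry.
    apply (is_RInt_unique (V := C_R_CompleteNormedModule)).
    apply (is_RInt_ext (V := C_R_NormedModule) (fun a => RtoC (F n a))).
    + rewrite Rmin_left, Rmax_right by nra. intros x Hx.
      apply Zceil_cell in Hx; [|exact Hn].
      rewrite !I_B_sum_block by (assumption || now (left + right)).
      unfold F. simpl amplitude. set (t := Zceil (x * INR n)).
      replace (/ 4 * (A n t * B n t)) with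
        (exp (2 * INR n * theta) * (exp (- theta) ^ n) ^ 2 * (/ 4 * (A n t * B n t)))
        by (rewrite exp_decay_pow; ring).
      apply injective_projections; simpl; field.
    + apply is_RInt_Cpair.
      * apply (RInt_correct (V := R_CompleteNormedModule)). eexists.
        apply (is_RInt_block (F n) (fun t => / 4 * (A n t * B n t)) n _ _ Hn Hfl).
        reflexivity.
      * apply (is_RInt_ext (fun _ => 0)); [reflexivity|].
        evar_last; [apply (is_RInt_const (V := R_NormedModule))|].
        unfold scal; simpl; unfold mult; simpl; ring.
  - apply filterlim_locally. intros e.
    destruct (proj1 (lim_seq_eps _ _) HF e (cond_pos e)) as [N HN].
    exists N. intros n Hn. specialize (HN n Hn).
    split; [exact HN|]. apply (ball_center (0 : R_UniformSpace)).
Qed.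
End Conclusion.

Theorem lemma3p6 :
  forall (theta : R) (r : nat -> R -> @matrix C 4 1)
         (l : nat -> R -> @matrix C 1 4) (eps : R),
    0 < theta < 2 * PI ->
    0 < cos theta ->
    B_eigensystem theta r l ->
    0 < eps < 1 / 2 * cos theta ->
    forall y1 y2 : R,
      - cos theta + eps <= y1 -> y1 < y2 -> y2 <= cos theta - eps ->
      is_lim_seq
        (fun n => INR n *
           RInt (fun a => exp (2 * INR n * theta) *
                          Cmod (I_B_sum theta r l n 0 (Zceil (a * INR n))) ^ 2)
             (1 / INR n * IZR (Zfloor (INR n * y1)))
             (1 / INR n * IZR (Zfloor (INR n * y2))))
        (1 / 8 * RInt (fun a => (1 + a) ^ 2 * fK a theta) y1 y2)
      /\
      is_lim_seq
        (fun n => INR n *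
           RInt (fun a => exp (2 * INR n * theta) *
                          Cmod (I_B_sum theta r l n 1 (Zceil (a * INR n))) ^ 2)
             (1 / INR n * IZR (Zfloor (INR n * y1)))
             (1 / INR n * IZR (Zfloor (INR n * y2))))
        (1 / 8 * RInt (fun a => (1 - a ^ 2) * fK a theta) y1 y2)
      /\
      filterlim
        (fun n => (INR n *
           RInt (V := C_R_CompleteNormedModule)
             (fun a => exp (2 * INR n * theta) *
                       I_B_sum theta r l n 0 (Zceil (a * INR n)) *
                       Cconj (I_B_sum theta r l n 1 (Zceil (a * INR n))))
             (1 / INR n * IZR (Zfloor (INR n * y1)))
             (1 / INR n * IZR (Zfloor (INR n * y2))))%C)
        eventually
        (locally (RtoC
          (1 / 8 * RInt (fun a => a * (1 + a) * tan theta * fK a theta) y1 y2))).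
Proof.
  intros theta r l eps Htheta Hc HB Heps y1 y2 Hy1 Hy Hy2.
  assert (Hs : sin theta <> 0).
  { intros E. destruct (sin_eq_O_2PI_0 theta) as [E0|[E0|E0]]; try lra.
    subst theta. rewrite cos_PI in Hc. lra. }
  split; [|split].
  - apply lim_RInt_modulus; try lra; try assumption; [now left|].
    apply block_limit_AA; lra.
  - apply lim_RInt_modulus; try lra; try assumption; [now right|].
    apply block_limit_BB; lra.
  - apply lim_RInt_correlation; try lra; try assumption.
    apply block_limit_AB; lra.
Qed.
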